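(* Let $X=\mathbf J$ be the James space, let $e_n=(0,\dots,0,1,0,\dots)$ (the $n$th entry is $1$, the others $0$), and let $e=(1,1,\dots,1,\dots)\in\mathbf J^{**}$. Let $A:\mathbf J\rightrightarrows\mathbf J^*$ be defined by $$\operatorname{gra}A:=\Big\{\Big(\sum_n\big(-\sum_{i>n}\langle e_i,y^*\rangle+\sum_{i<n}\langle e_i,y^*\rangle\big)e_n,\ y^*\Big)\in\mathbf J\times\mathbf J^*\ \Big|\ y^*\in\{e\}_\bot\Big\}.$$ Then $A$ is a maximally monotone and skew operator that is neither of type (BR) nor unique, and so $A$ is not of type (D). Hence, every Banach space that contains an isomorphic copy of $\mathbf J$ is not of type (D).
   Context: All Banach spaces are real; a Banach space $X$ is identified with its canonical image in $X^{**}$, and $\langle\cdot,\cdot\rangle$ denotes duality pairings (arguments in either order). The James space $\mathbf J$ consists of all sequences $x=(x_n)_{n\in\mathbb N}$ in $c_0$ with finite norm $$\|x\|:=\sup_{n_1<\cdots<n_k}\big((x_{n_1}-x_{n_2})^2+(x_{n_2}-x_{n_3})^2+\cdots+(x_{n_{k-1}}-x_{n_k})^2\big)^{1/2}.$$ It is a known fact that $(e_n)$ (with its coordinate functionals $e_n^*$) is a shrinking Schauder basis of $\mathbf J$ and that $\mathbf J^{**}=\mathbf J\oplus\operatorname{span}\{e\}$, where $e=(1,1,\dots)$ is the constant sequence, i.e. the element of $\mathbf J^{**}$ with $\langle e,e_n^*\rangle=1$ for all $n$. $\{e\}_\bot=\{y^*\in\mathbf J^*\mid\langle e,y^*\rangle=0\}$.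 The graph of $A$ consists of those pairs for which $y^*\in\{e\}_\bot$ and the displayed series over $n$ converges in $\mathbf J$. A set-valued operator $B:X\rightrightarrows X^*$ has graph $\operatorname{gra}B=\{(x,x^* )\mid x^*\in Bx\}$. It is monotone if $\langle x-y,x^*-y^*\rangle\ge0$ for all $(x,x^* ),(y,y^* )\in\operatorname{gra}B$, maximally monotone if moreover it has no proper monotone extension (graph inclusion), and skew if $\langle x,x^*\rangle=0$ for all $(x,x^* )\in\operatorname{gra}B$. A maximally monotone $B:X\rightrightarrows X^*$ is: - of type (D) if for every $(x^{**},x^* )\in X^{**}\times X^*$ with $\inf_{(a,a^* )\in\operatorname{gra}B}\langle a-x^{**},a^*-x^*\rangle\ge0$ there is a bounded net in $\operatorname{gra}B$ converging weak$^*\times$strong to $(x^{**},x^* )$; - of type (BR) if whenever $(x,x^* )\in X\times X^*$, $\alpha,\beta>0$ and $\inf_{(a,a^* )\in\operatorname{gra}B}\langle x-a,x^*-a^*\rangle>-\alpha\beta$, there exists $(b,b^* )\in\operatorname{gra}B$ with $\|x-b\|<\alpha$ and $\|x^*-b^*\|<\beta$; - unique if all maximally monotone extensions of $B$ (graph inclusion) in $X^{**}\times X^*$ coincide. A Banach space is of type (D) if every maximally monotone operator on it is of type (D). *)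

(* Defs.v *)
From HB Require Import structures.
From mathcomp Require Import all_boot all_order all_algebra.
From mathcomp Require Import all_classical all_reals all_analysis.
From mathcomp Require Import lra.

Set Implicit Arguments.
Unset Strict Implicit.
Unset Printing Implicit Defensive.

Import Order.TTheory GRing.Theory Num.Theory.
Import numFieldTopology.Exports numFieldNormedType.Exports.

Local Open Scope classical_set_scope.
Local Open Scope ring_scope.

Definition dual_fun (R : realType) (X : normedModType R) : {pred X -> R^o} :=
  [pred f | `[< linear f /\ continuous f >]].

Arguments dual_fun {R} X.

Record dual (R : realType) (X : normedModType R) :=
  Dual { dual_val :> X -> R^o ; _ : dual_val \in dual_fun X }.

Arguments dual {R} X.

HB.instance Definition _ (R : realType) (X : normedModType R) :=
  [isSub for @dual_val R X].
HB.instance Definition _ (R : realType) (X : normedModType R) :=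
  [Choice of dual X by <:].

Lemma dual_submod_closed (R : realType) (X : normedModType R) :
  submod_closed (dual_fun X).
Proof.
split.
  apply/asboolP; split; first by move=> a x y; rewrite scaler0 addr0.
  by move=> x; exact: cvg_cst.
move=> a f g /asboolP[lf cf] /asboolP[lg cg]; apply/asboolP; split.
  move=> b x y; rewrite /GRing.add /GRing.scale/=.
  rewrite lf lg /GRing.scale/=.
  by rewrite !mulrDr addrACA mulrCA.
move=> x; apply: cvgD; last exact: cg.
by apply: cvgM; [exact: cvg_cst | exact: cf].
Qed.

HB.instance Definition _ (R : realType) (X : normedModType R) :=
  GRing.isSubmodClosed.Build _ _ (dual_fun X) (@dual_submod_closed R X).
HB.instance Definition _ (R : realType) (X : normedModType R) :=
  [SubChoice_isSubLmodule of dual X by <:].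

Section dual_theory.
Context (R : realType) (X : normedModType R).
Implicit Types f g : dual X.

Lemma dual_is_linear f : linear f.
Proof. by have /asboolP[] := valP f. Qed.

HB.instance Definition _ f :=
  GRing.isLinear.Build R X R^o *:%R (dual_val f) (@dual_is_linear f).

Lemma dual_continuous f : continuous f.
Proof. by have /asboolP[] := valP f. Qed.

Lemma dual_eqP f g : f =1 g -> f = g.
Proof. by move=> fg; apply/val_inj/funext. Qed.

Lemma dualDE f g x : (f + g) x = f x + g x. Proof. by []. Qed.
Lemma dualZE a f x : (a *: f) x = a * f x. Proof. by []. Qed.

Definition dual_norm f : R := sup [set `|f x| | x in [set x | `|x| <= 1]].

Let dual_norm_has_sup f :
  has_sup [set `|f x| | x in [set x | `|x| <= 1]].
Proof.
split; first by exists `|f 0|; exists 0 => //=; rewrite normr0.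
have /linear_boundedP/pinfty_ex_gt0[r r0 fr] :
    bounded_near (dual_val f) (nbhs (0 : X)).
  exact/linear_bounded_continuous/dual_continuous.
exists r => _ [x /= x1 <-]; apply: (le_trans (fr x)).
by rewrite -[leRHS]mulr1 ler_wpM2l// ltW.
Qed.

Lemma dual_norm_ub f x : `|f x| <= dual_norm f * `|x|.
Proof.
have [->|x0] := eqVneq x 0.
  by rewrite linear0 !normr0 mulr0.
rewrite -ler_pdivrMr ?normr_gt0//.
apply: sup_upper_bound; first exact: dual_norm_has_sup.
exists (`|x|^-1 *: x) => /=; first by rewrite normfZV.
by rewrite linearZ/= normrM normfV normr_id mulrC.
Qed.

Lemma dual_norm_le f C : (forall x, `|x| <= 1 -> `|f x| <= C) ->
  dual_norm f <= C.
Proof.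
move=> fC; apply: ge_sup; first by case: (dual_norm_has_sup f).
by move=> _ [x /= x1 <-]; exact: fC.
Qed.

Lemma dual_norm_le1 f x : `|x| <= 1 -> `|f x| <= dual_norm f.
Proof.
move=> x1; apply: sup_upper_bound; first exact: dual_norm_has_sup.
by exists x.
Qed.

Let dual_ler_normD f g : dual_norm (f + g) <= dual_norm f + dual_norm g.
Proof.
apply: dual_norm_le => x x1; rewrite dualDE.
by rewrite (le_trans (ler_normD _ _))// lerD// dual_norm_le1.
Qed.

Let dual_normrZ a f : dual_norm (a *: f) = `|a| * dual_norm f.
Proof.
have le b g : dual_norm (b *: g) <= `|b| * dual_norm g.
  apply: dual_norm_le => x x1.
  by rewrite dualZE normrM ler_wpM2l// dual_norm_le1.
have [->|a0] := eqVneq a 0.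
  apply/eqP; rewrite eq_le le/= normr0 mul0r.
  by rewrite (le_trans _ (@dual_norm_le1 _ 0 _)) ?normr0.
apply/eqP; rewrite eq_le le/= -ler_pdivlMl ?normr_gt0//.
have := le a^-1 (a *: f).
by rewrite scalerA mulVf// scale1r normfV.
Qed.

Let dual_normr0_eq0 f : dual_norm f = 0 -> f = 0.
Proof.
move=> f0; apply: dual_eqP => x.
by have := dual_norm_ub f x; rewrite f0 mul0r normr_le0 => /eqP.
Qed.

HB.instance Definition _ := Lmodule_isNormed.Build R (dual X)
  dual_ler_normD dual_normrZ dual_normr0_eq0.

Lemma dual_normE f : `|f| = sup [set `|f x| | x in [set x | `|x| <= 1]].
Proof. by []. Qed.

Lemma ler_dual f x : `|f x| <= `|f| * `|x|.
Proof. exact: dual_norm_ub. Qed.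

Lemma bounded_dual_fun (f : X -> R^o) (C : R) :
  linear f -> (forall x, `|f x| <= C * `|x|) -> f \in dual_fun X.
Proof.
move=> lf fC; apply/asboolP; split=> //.
pose F : {linear X -> R^o} := HB.pack f (GRing.isLinear.Build R X R^o *:%R f lf).
apply: (@bounded_linear_continuous _ _ _ F).
apply/bounded_funP => r; exists (`|C| * r) => x xr /=.
rewrite (le_trans (fC x))// (@le_trans _ _ (`|C| * `|x|))//.
  by rewrite ler_wpM2r// ler_norm.
by rewrite ler_wpM2l.
Qed.

End dual_theory.

Section canon.
Context (R : realType) (X : normedModType R).

Lemma eval_dual_fun (x : X) : (fun f : dual X => f x) \in dual_fun (dual X).
Proof.
apply: (@bounded_dual_fun _ _ _ `|x|) => // f.
by rewrite mulrC ler_dual.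
Qed.

Definition canon (x : X) : dual (dual X) := Dual (eval_dual_fun x).

End canon.

Section james_variation.
Context (R : realType).
Implicit Types (x y : nat -> R^o) (s : seq nat).

(* For s = [:: n_1; ...; n_k] this is the sum of the k - 1 squares
   (x n_j - x n_(j+1))^2; sequences are indexed from 0. *)
Definition james_var x s : R :=
  \sum_(0 <= i < (size s).-1) (x (nth 0%N s i) - x (nth 0%N s i.+1)) ^+ 2.

Definition james_vars x : set R :=
  [set Num.sqrt (james_var x s) | s in [set s | sorted ltn s]].

Definition james_norm x : R := sup (james_vars x).

Definition james_fun : {pred nat -> R^o} :=
  [pred x | `[< x @ \oo --> (0 : R) /\ has_ubound (james_vars x) >]].

Lemma james_var_ge0 x s : 0 <= james_var x s.
Proof. by apply: sumr_ge0 => i _; exact: sqr_ge0. Qed.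

Let mink2 (p q t a b : R) : 0 <= p -> 0 <= q -> 0 <= t -> t <= p + q ->
  Num.sqrt (t ^+ 2 + (a + b) ^+ 2) <=
  Num.sqrt (p ^+ 2 + a ^+ 2) + Num.sqrt (q ^+ 2 + b ^+ 2).
Proof.
move=> p0 q0 t0 tpq.
set u := Num.sqrt (p ^+ 2 + _); set v := Num.sqrt (q ^+ 2 + _).
have u0 : 0 <= u by exact: sqrtr_ge0.
have v0 : 0 <= v by exact: sqrtr_ge0.
have u2 : u ^+ 2 = p ^+ 2 + a ^+ 2 by rewrite sqr_sqrtr// addr_ge0 ?sqr_ge0.
have v2 : v ^+ 2 = q ^+ 2 + b ^+ 2 by rewrite sqr_sqrtr// addr_ge0 ?sqr_ge0.
have cs : p * q + a * b <= u * v.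
  rewrite (le_trans (ler_norm _))// -(ger0_norm (mulr_ge0 u0 v0)).
  rewrite -ler_sqr ?nnegrE ?normr_ge0// !real_normK ?num_real//.
  rewrite exprMn u2 v2.
  have : 0 <= (p * b - a * q) ^+ 2 by exact: sqr_ge0.
  nra.
rewrite -[leRHS]ger0_norm ?addr_ge0// -sqrtr_sqr ler_wsqrtr//.
nra.
Qed.

Let minkowski_sum (a b : nat -> R) n :
  Num.sqrt (\sum_(0 <= i < n) (a i + b i) ^+ 2) <=
  Num.sqrt (\sum_(0 <= i < n) a i ^+ 2) + Num.sqrt (\sum_(0 <= i < n) b i ^+ 2).
Proof.
elim: n => [|n ih]; first by rewrite !big_nil sqrtr0 addr0.
rewrite !big_nat_recr//=.
have sum0 (c : nat -> R) : 0 <= \sum_(0 <= i < n) c i ^+ 2.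
  by apply: sumr_ge0 => i _; exact: sqr_ge0.
rewrite -[X in Num.sqrt (X + _) <= _]sqr_sqrtr ?sum0//.
rewrite -[X in _ <= Num.sqrt (X + _) + _]sqr_sqrtr ?sum0//.
rewrite -[X in _ <= _ + Num.sqrt (X + _)]sqr_sqrtr ?sum0//.
by apply: mink2 => //; exact: sqrtr_ge0.
Qed.

Lemma james_varD x y s : Num.sqrt (james_var (x + y) s) <=
  Num.sqrt (james_var x s) + Num.sqrt (james_var y s).
Proof.
apply: le_trans (minkowski_sum _ _ _); rewrite ler_wsqrtr// le_eqVlt.
apply/orP; left; apply/eqP; apply: eq_bigr => i _; congr (_ ^+ 2).
by rewrite -[LHS]/((x _ + y _) - (x _ + y _)) opprD addrACA.
Qed.

Lemma james_varZ a x s :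
  Num.sqrt (james_var (a *: x) s) = `|a| * Num.sqrt (james_var x s).
Proof.
rewrite -sqrtr_sqr -sqrtrM ?sqr_ge0//; congr Num.sqrt.
rewrite /james_var mulr_sumr; apply: eq_bigr => i _.
by rewrite -exprMn mulrBr.
Qed.

Lemma james_vars_nonempty x : james_vars x !=set0.
Proof. by exists (Num.sqrt (james_var x [::])); exists [::]. Qed.

Lemma james_submod_closed : submod_closed james_fun.
Proof.
split.
  apply/asboolP; split; first exact: cvg_cst.
  exists 0 => _ [s _ <-]; rewrite /james_var big1 ?sqrtr0// => i _.
  by rewrite subrr expr0n.
move=> a x y /asboolP[x0 [C xC]] /asboolP[y0 [D yD]]; apply/asboolP; split.
  have -> : (0 : R) = a * 0 + 0 by rewrite mulr0 addr0.
  by apply: cvgD => //; apply: cvgM => //; exact: cvg_cst.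
exists (`|a| * C + D) => _ [s ss <-]; apply: (le_trans (james_varD _ _ _)).
rewrite james_varZ lerD//; last by apply: yD; exists s.
by rewrite ler_wpM2l//; apply: xC; exists s.
Qed.

HB.instance Definition _ :=
  GRing.isSubmodClosed.Build _ _ james_fun james_submod_closed.

End james_variation.

Arguments james_fun : clear implicits.

Record james (R : realType) :=
  James { james_val :> nat -> R^o ; _ : james_val \in james_fun R }.

HB.instance Definition _ (R : realType) := [isSub for @james_val R].
HB.instance Definition _ (R : realType) := [Choice of james R by <:].
HB.instance Definition _ (R : realType) :=
  [SubChoice_isSubLmodule of james R by <:].

Section james_normed.
Context (R : realType).
Implicit Types x y : james R.

Lemma james_cvg0 x : x @ \oo --> (0 : R).
Proof. by have /asboolP[] := valP x. Qed.

Lemma james_has_ubound x : has_ubound (james_vars x).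
Proof. by have /asboolP[] := valP x. Qed.

Lemma james_eqP x y : x =1 y -> x = y.
Proof. by move=> xy; apply/val_inj/funext. Qed.

Lemma jamesDE x y n : (x + y) n = x n + y n. Proof. by []. Qed.
Lemma jamesBE x y n : (x - y) n = x n - y n. Proof. by []. Qed.
Lemma jamesZE a x n : (a *: x) n = a * x n. Proof. by []. Qed.

Lemma james_norm_ub x s : sorted ltn s ->
  Num.sqrt (james_var x s) <= james_norm x.
Proof.
move=> ss; apply: sup_upper_bound; last by exists s.
by split; [exact: james_vars_nonempty|exact: james_has_ubound].
Qed.

Lemma james_norm_le x C : (forall s, sorted ltn s ->
  Num.sqrt (james_var x s) <= C) -> james_norm x <= C.
Proof.
move=> xC; apply: ge_sup; first exact: james_vars_nonempty.
by move=> _ [s ss <-]; exact: xC.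
Qed.

Let james_coord_norm x n : `|x n| <= james_norm x.
Proof.
have xn m : (n < m)%N -> `|x n - x m| <= james_norm x.
  move=> nm; have := @james_norm_ub x [:: n; m].
  rewrite /= nm /james_var/= big_nat1/= sqrtr_sqr; exact.
have : (fun m => `|x n - x m|) @ \oo --> `|x n - 0|.
  by apply: cvg_norm; apply: cvgB; [exact: cvg_cst|exact: james_cvg0].
rewrite subr0 => xcvg.
rewrite -(cvg_lim _ xcvg)//; apply: limr_le; first by apply/cvg_ex; exists `|x n|.
near=> m; apply: xn; near: m; exact: nbhs_infty_gt.
Unshelve. all: by end_near. Qed.

Let james_ler_normD x y : james_norm (x + y : james R) <= james_norm x + james_norm y.
Proof.
apply: james_norm_le => s ss; rewrite (le_trans (james_varD _ _ _))// lerD//.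
  exact: james_norm_ub.
exact: james_norm_ub.
Qed.

Let james_normrZ a x : james_norm (a *: x : james R) = `|a| * james_norm x.
Proof.
have le b z : james_norm (b *: z : james R) <= `|b| * james_norm z.
  by apply: james_norm_le => s ss; rewrite james_varZ ler_wpM2l// james_norm_ub.
have [->|a0] := eqVneq a 0.
  apply/eqP; rewrite eq_le le/= normr0 mul0r.
  exact: le_trans (sqrtr_ge0 _) (@james_norm_ub (0 *: x) [::] isT).
apply/eqP; rewrite eq_le le/= -ler_pdivlMl ?normr_gt0//.
have := le a^-1 (a *: x).
by rewrite scalerA mulVf// scale1r normfV.
Qed.

Let james_normr0_eq0 x : james_norm x = 0 -> x = 0.
Proof.
move=> x0; apply: james_eqP => n.
by have := james_coord_norm x n; rewrite x0 normr_le0 => /eqP.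
Qed.

HB.instance Definition _ := Lmodule_isNormed.Build R (james R)
  james_ler_normD james_normrZ james_normr0_eq0.

Lemma james_normE x :
  `|x| = sup [set Num.sqrt (james_var x s) | s in [set s | sorted ltn s]].
Proof. by []. Qed.

Lemma james_var_norm x s : sorted ltn s -> Num.sqrt (james_var x s) <= `|x|.
Proof. exact: james_norm_ub. Qed.

Lemma james_norm_leP x C : (forall s, sorted ltn s ->
  Num.sqrt (james_var x s) <= C) -> `|x| <= C.
Proof. exact: james_norm_le. Qed.

Lemma ler_james_coord x n : `|x n| <= `|x|.
Proof. exact: james_coord_norm. Qed.

Lemma james_coord_dual_fun n : (fun x : james R => x n) \in dual_fun (james R).
Proof.
apply: (@bounded_dual_fun _ _ _ 1) => // x.
by rewrite mul1r; exact: ler_james_coord.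
Qed.

Definition james_coord n : dual (james R) := Dual (james_coord_dual_fun n).

End james_normed.

Section james_complete.
Context (R : realType).

Lemma james_cauchy_cvg (F : set_system (james R)) :
  ProperFilter F -> cauchy F -> cvg F.
Proof.
move=> FF /cauchy_ballP Fc.
have coordF n : cvg ((fun x : james R => (x n : R)) @ F).
  apply: R_complete; apply/cauchy_ballP => e e0.
  have [[A B] /= [FA FB] AB] := Fc _ e0.
  exists ((fun x : james R => (x n : R)) @` A,
          (fun x : james R => (x n : R)) @` B).
    by split => /=; [apply: filterS FA|apply: filterS FB] => x xA; exists x.
  move=> [a b] /= [[x Ax <-] [y By <-]].
  have := AB (x, y) (conj Ax By); rewrite -!ball_normE /=.
  exact/le_lt_trans/(ler_james_coord (x - y)).
pose l : nat -> R^o := fun n => lim ((fun x : james R => (x n : R)) @ F).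
have lF n : (fun x : james R => (x n : R)) @ F --> (l n : R) by exact: coordF.
have close (e : R) : 0 < e -> F [set x : james R |
    (forall n, `|x n - l n| <= e) /\
    forall s, sorted ltn s -> Num.sqrt (james_var (james_val x - l) s) <= e].
  move=> e0; have [[A B] /= [FA FB] AB] := Fc _ e0.
  near=> x => /=.
  have xy : \forall y \near F, `|x - y| <= e.
    apply: filterS FB => y By.
    have : A x by near: x.
    by move=> Ax; have := AB (x, y) (conj Ax By); rewrite -ball_normE => /ltW.
  split=> [n|s ss].
    have xcvg : (fun y : james R => `|x n - y n|) @ F --> `|x n - l n|.
      by apply: cvg_norm; apply: cvgB; [exact: cvg_cst|exact: lF].
    rewrite -(cvg_lim _ xcvg)//; apply: limr_le.
      by apply/cvg_ex; exists `|x n - l n|.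
    by apply: filterS xy => y; exact/le_trans/(ler_james_coord (x - y)).
  have xcvg : (fun y : james R => Num.sqrt (james_var (x - y) s)) @ F -->
              Num.sqrt (james_var (james_val x - l) s).
    suff jc : (fun y : james R => james_var (x - y) s) @ F -->
        james_var (james_val x - l) s.
      exact: (cvg_comp _ _ jc (@sqrt_continuous R _)).
    apply: cvg_big => [|i _]; first exact: add_continuous.
    have cx m : (fun y : james R => (x - y) m) @ F --> (x m - l m : R).
      by apply: cvgB; [exact: cvg_cst|exact: lF].
    have cc := cvgB (cx (nth 0%N s i)) (cx (nth 0%N s i.+1)).
    have {}cc := cc (@filter_filter _ _ FF).
    by rewrite expr2; under eq_cvg do rewrite expr2; exact: (cvgM cc cc).
  rewrite -(cvg_lim _ xcvg)//; apply: limr_le.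
    by apply/cvg_ex; eexists; exact: xcvg.
  by apply: filterS xy => y; apply: le_trans; exact: james_var_norm.
have lP : l \in james_fun R.
  apply/asboolP; split.
    apply/cvgr0Pnorm_le => e e0.
    have e20 : 0 < e / 2 by rewrite divr_gt0.
    have [x [xl _]] := filter_ex (close _ e20).
    have /cvgr0Pnorm_le/(_ _ e20) := @james_cvg0 _ x.
    apply: filterS => n xn.
    rewrite -(subrK (x n) (l n)) (le_trans (ler_normD _ _))//.
    by rewrite [leRHS]splitr lerD// distrC.
  have [x [_ xl]] := filter_ex (close _ ltr01).
  exists (`|x| + 1) => _ [s ss <-].
  have -> : l = james_val x + (-1) *: (james_val x - l).
    by rewrite scaleN1r opprB addrC subrK.
  rewrite (le_trans (james_varD _ _ _))// james_varZ normrN1 mul1r.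
  by rewrite lerD ?james_var_norm// xl.
apply/cvg_ex; exists (James lP); apply/cvgrPdist_le => e e0.
apply: filterS (close _ e0) => x [_ xl].
by rewrite distrC; apply: james_norm_leP => s ss; exact: xl.
Unshelve. all: by end_near. Qed.

HB.instance Definition _ := Uniform_isComplete.Build (james R) james_cauchy_cvg.

End james_complete.

Section james_basis.
Context (R : realType).

Lemma james_var_TV (x : nat -> R^o) (V : R) :
  (forall i, `|x i| <= 1) ->
  (forall m, \sum_(0 <= i < m) `|x i.+1 - x i| <= V) ->
  forall s, sorted ltn s -> james_var x s <= 2 * V.
Proof.
move=> x1 xV.
have V0 : 0 <= V by have := xV 0%N; rewrite big_nil.
have pathV a s : path ltn a s ->
    (a <= last a s)%N /\
    james_var x (a :: s) <= 2 * \sum_(a <= i < last a s) `|x i.+1 - x i|.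
  elim: s a => [|b s ih] a /=; first by rewrite /james_var !big_geq ?mulr0.
  case/andP => ab /ih[bl jv]; split; first exact: leq_trans (ltnW ab) bl.
  rewrite (big_cat_nat (ltnW ab) bl)/= mulrDr.
  rewrite /james_var/= big_nat_recl//= lerD//.
  rewrite -real_normK ?num_real// expr2 ler_pM//.
    rewrite (le_trans (ler_normB _ _))//.
    by have := x1 a; have := x1 b; lra.
  rewrite distrC -telescope_sumr ?(ltnW ab)//.
  exact: ler_norm_sum.
move=> [|a s] /=; first by rewrite /james_var/= big_nil mulr_ge0.
move=> /pathV[al]; move/le_trans; apply; rewrite ler_wpM2l//.
apply: le_trans (xV (last a s)); rewrite [leRHS](big_cat_nat (leq0n a) al)/=.
by rewrite lerDr sumr_ge0.
Qed.

Definition james_step_fun (n : nat) : nat -> R^o := fun i => (i < n)%N%:R.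

Let step_fun_le1 n i : `|james_step_fun n i| <= 1.
Proof. by rewrite /james_step_fun normr_nat lern1 leq_b1. Qed.

Let step_fun_TV n m :
  \sum_(0 <= i < m) `|james_step_fun n i.+1 - james_step_fun n i| <= 1.
Proof.
have -> : \sum_(0 <= i < m) `|james_step_fun n i.+1 - james_step_fun n i| =
    - (james_step_fun n m - james_step_fun n 0).
  rewrite -telescope_sumr// -sumrN; apply: eq_bigr => i _.
  rewrite ler0_norm// subr_le0 ler_nat.
  by case: (ltnP i.+1 n) => // /ltnW ->.
rewrite opprB lerBlDr (@le_trans _ _ 1)//; last by rewrite lerDl ler0n.
by rewrite lern1 leq_b1.
Qed.

Lemma james_step_fun_in n : james_step_fun n \in james_fun R.
Proof.
apply/asboolP; split.
  apply: cvg_near_cst; exists n => // i /= ni.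
  by rewrite /james_step_fun ltnNge ni.
exists (Num.sqrt (2 * 1)) => _ [s ss <-]; rewrite ler_wsqrtr//.
exact: james_var_TV.
Qed.

Lemma james_basis_in n : (fun i => (i == n)%:R) \in james_fun R.
Proof.
have -> : (fun i => (i == n)%:R) = james_step_fun n.+1 - james_step_fun n.
  apply/funext => i; rewrite -[RHS]/(james_step_fun _ i - james_step_fun _ i).
  by rewrite /james_step_fun ltnS; case: ltngtP; rewrite ?subrr ?subr0.
by rewrite rpredB// james_step_fun_in.
Qed.

Definition james_basis n : james R := James (james_basis_in n).

Definition james_step n : james R := \sum_(0 <= i < n) james_basis i.

Lemma james_stepE n i : james_step n i = (i < n)%N%:R.
Proof.
rewrite /james_step; elim: n => [|n ih]; first by rewrite big_nil.
rewrite big_nat_recr//= -[LHS]/(james_val _ i + _) ih/= ltnS.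
by case: ltngtP; rewrite ?addr0 ?add0r.
Qed.

Lemma james_norm_TV (x : james R) (V : R) :
  (forall i, `|x i| <= 1) ->
  (forall m, \sum_(0 <= i < m) `|x i.+1 - x i| <= V) ->
  `|x| <= Num.sqrt (2 * V).
Proof.
move=> x1 xV; apply: james_norm_leP => s ss.
by rewrite ler_wsqrtr// james_var_TV.
Qed.

Let step_TV n m : \sum_(0 <= i < m) `|james_step n i.+1 - james_step n i| <= 1.
Proof. by under eq_bigr do rewrite !james_stepE; exact: step_fun_TV. Qed.

Lemma james_step_norm n : `|james_step n| <= Num.sqrt 2.
Proof.
rewrite -[2]mulr1; apply: james_norm_TV; last exact: step_TV.
by move=> i; rewrite james_stepE; exact: step_fun_le1.
Qed.

Lemma james_dual_step (y : dual (james R)) n :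
  y (james_step n) = series (fun i => y (james_basis i)) n.
Proof. by rewrite /james_step linear_sum. Qed.

Lemma james_dual_cvg (y : dual (james R)) :
  cvgn (series (fun i => (y (james_basis i) : R))).
Proof.
apply/cauchy_cvgP/cauchy_seriesP => e e0; apply: contrapT => ncvg.
have block N : exists n1 n2, [/\ (N < n1)%N, (n1 <= n2)%N &
    e <= `|y (james_step n2 - james_step n1)|].
  apply: contrapT => nblock; apply: ncvg.
  exists ([set n | (N < n)%N], [set n | (N < n)%N]) => /=.
    by split; exact: nbhs_infty_gt.
  move=> [n1 n2] /= [Nn1 Nn2]; rewrite ltNge; apply/negP => en.
  have [n21|n12] := ltnP n2 n1.
    by move: en; rewrite big_geq ?normr0 ?leNgt ?e0// ltnW.
  apply: nblock; exists n1, n2; split => //.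
  by rewrite linearB/= !james_dual_step sub_series_geq.
have steps K N : exists x : james R, [/\ forall i, (i <= N)%N -> x i = 0,
    forall i, `|x i| <= 1,
    forall m, \sum_(0 <= i < m) `|x i.+1 - x i| <= 2 * K%:R &
    K%:R * e <= y x].
  elim: K N => [|K ih] N.
    exists 0; split.
    - by [].
    - by move=> i; rewrite normr0.
    - by move=> m; rewrite mulr0 big1// => i _; rewrite subrr normr0.
    - by rewrite mul0r linear0.
  have [n1 [n2 [Nn1 n12 en]]] := block N.
  have [x [x0 x1 xV yx]] := ih n2.
  have [u uB yu] : exists2 u : james R,
      forall i, u i = james_step n2 i - james_step n1 i & e <= `|y u|.
    by exists (james_step n2 - james_step n1).
  have uE i : u i = (n1 <= i < n2)%N%:R.
    rewrite uB !james_stepE (leqNgt n1 i).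
    case: (ltnP i n1) => [in1|_]/=; last by rewrite subr0.
    by rewrite (leq_trans in1 n12) subrr.
  have uV m : \sum_(0 <= i < m) `|u i.+1 - u i| <= 2.
    have : \sum_(0 <= i < m) `|u i.+1 - u i| <=
        \sum_(0 <= i < m) `|james_step n2 i.+1 - james_step n2 i| +
        \sum_(0 <= i < m) `|james_step n1 i.+1 - james_step n1 i|.
      rewrite -big_split; apply: ler_sum => i _.
      have -> : u i.+1 - u i = (james_step n2 i.+1 - james_step n2 i) -
          (james_step n1 i.+1 - james_step n1 i) by rewrite !uB; lra.
      exact: ler_normB.
    by have := step_TV n2 m; have := step_TV n1 m; lra.
  pose c := Num.sg (y u).
  have c1 : `|c| <= 1 by rewrite normr_sg lern1 leq_b1.
  exists (c *: u + x); split.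
  - move=> i iN; rewrite jamesDE jamesZE uE x0 ?addr0; last first.
      by rewrite (leq_trans iN)// (leq_trans (ltnW Nn1)).
    by rewrite (leqNgt n1 i) (leq_ltn_trans iN Nn1) mulr0.
  - move=> i; rewrite jamesDE jamesZE uE.
    have [in2|n2i] := ltnP i n2.
      rewrite x0 ?(ltnW in2)// addr0 normrM mulr_ile1// normr_nat.
      by rewrite lern1 leq_b1.
    by rewrite andbF mulr0 add0r.
  - move=> m.
    have : \sum_(0 <= i < m) `|(c *: u + x) i.+1 - (c *: u + x) i| <=
        \sum_(0 <= i < m) `|u i.+1 - u i| + \sum_(0 <= i < m) `|x i.+1 - x i|.
      rewrite -big_split; apply: ler_sum => i _.
      have -> : (c *: u + x) i.+1 - (c *: u + x) i =
          c * (u i.+1 - u i) + (x i.+1 - x i).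
        by rewrite !jamesDE !jamesZE mulrBr opprD addrACA.
      rewrite (le_trans (ler_normD _ _))// lerD// normrM.
      by rewrite ler_piMl.
    by have := uV m; have := xV m; rewrite -natr1; lra.
  - rewrite linearD linearZ/= -[X in X + _]/(c * y u) -normrEsg.
    rewrite -natr1 mulrDl mul1r addrC lerD//.
have bnd K : K%:R * e ^+ 2 <= 4 * `|y| ^+ 2.
  have [x [_ x1 xV yx]] := steps K 0%N.
  have [->|K0] := eqVneq K 0%N; first by rewrite mul0r mulr_ge0 ?sqr_ge0.
  have K0' : (0 : R) < K%:R by rewrite ltr0n lt0n.
  rewrite -(ler_pM2l K0').
  have : K%:R * e <= `|y| * Num.sqrt (2 * (2 * K%:R)).
    rewrite (le_trans yx)// (le_trans (ler_norm _))// (le_trans (ler_dual _ _))//.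
    by rewrite ler_wpM2l// james_norm_TV.
  move=> /(lerXn2r 2); rewrite ?nnegrE ?mulr_ge0 ?ler0n ?sqrtr_ge0 ?(ltW e0)//.
  move=> /(_ isT isT); rewrite !exprMn sqr_sqrtr; last by rewrite !mulr_ge0.
  by lra.
have e20 : 0 < e ^+ 2 by rewrite exprn_gt0.
have := bnd (Num.bound (4 * `|y| ^+ 2 / e ^+ 2)).
rewrite leNgt => /negP; apply; rewrite -ltr_pdivrMr//.
apply: archi_boundP; apply: divr_ge0; last exact: ltW.
by apply: mulr_ge0 => //; exact: sqr_ge0.
Qed.

Lemma james_one_exists : exists z : dual (dual (james R)),
  forall n, z (james_coord R n) = 1.
Proof.
pose f (y : dual (james R)) : R^o :=
  limn (series (fun i => (y (james_basis i) : R))).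
have fcvg (y : dual (james R)) : series (fun i => (y (james_basis i) : R)) @ \oo --> (f y : R).
  exact: james_dual_cvg.
have fl : linear f.
  move=> a y z; apply/cvg_lim => //.
  have -> : series (fun i => ((a *: y + z) (james_basis i) : R)) =
      (fun n => a * series (fun i => (y (james_basis i) : R)) n +
                series (fun i => (z (james_basis i) : R)) n).
    by apply/funext => n; rewrite /series/= mulr_sumr -big_split.
  by apply: cvgD; [apply: cvgM; [exact: cvg_cst|exact: fcvg]|exact: fcvg].
have fb (y : dual (james R)) : `|f y| <= Num.sqrt 2 * `|y|.
  have ycvg : (fun n => `|series (fun i => (y (james_basis i) : R)) n|) @ \oo --> `|f y|.
    by apply: cvg_norm; exact: fcvg.
  rewrite -(cvg_lim _ ycvg)//; apply: limr_le.
    by apply/cvg_ex; eexists; exact: ycvg.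
  apply: nearW => n /=.
  rewrite -james_dual_step (le_trans (ler_dual _ _))// mulrC.
  by rewrite ler_wpM2r// james_step_norm.
exists (Dual (bounded_dual_fun fl fb)) => n.
rewrite -[LHS]/(f (james_coord R n)).
apply/cvg_lim => //; apply: cvg_near_cst; exists n.+1 => // N /= nN.
rewrite -[LHS]/(series (fun i => james_coord R n (james_basis i)) N).
by rewrite -james_dual_step -[LHS]/(james_step N n) james_stepE nN.
Qed.

End james_basis.

(* The element (1, 1, ...) of the bidual of the James space. The coordinate
   functionals span a dense subspace of the dual, so the condition determines
   the element; james_one_exists shows that it can be satisfied. *)
Definition james_one (R : realType) : dual (dual (james R)) :=
  xget 0 [set z : dual (dual (james R)) | forall n, z (james_coord R n) = 1].

Lemma james_oneE (R : realType) n : james_one R (james_coord R n) = 1.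
Proof.
rewrite /james_one; case: xgetP => [z _ zP|nz]; first exact: zP.
by have [z zP] := james_one_exists R; case: (nz z).
Qed.

(* The pairing is a parameter, so that the same definitions apply to graphs in
   X * dual X and in dual (dual X) * dual X. *)
Section monotone.
Context (R : realType) (U V : zmodType) (p : U -> V -> R).

Definition monotone (G : set (U * V)) : Prop :=
  forall a b, G a -> G b -> 0 <= p (a.1 - b.1) (a.2 - b.2).

Definition maximally_monotone (G : set (U * V)) : Prop :=
  monotone G /\ forall H, monotone H -> G `<=` H -> H = G.

End monotone.

Section operators.
Context (R : realType) (X : normedModType R).
Implicit Types B : set (X * dual X).

Definition pairing (x : X) (xs : dual X) : R := xs x.

Definition bipairing (xss : dual (dual X)) (xs : dual X) : R := xss xs.

Definition skew_operator B : Prop := forall a, B a -> pairing a.1 a.2 = 0.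

Definition directed_preorder (I : Type) (le : I -> I -> Prop) : Prop :=
  [/\ inhabited I, forall i, le i i,
      forall i j k, le i j -> le j k -> le i k &
      forall i j, exists k, le i k /\ le j k].

(* The filter of tails of a directed set: a net a : I -> T converges to l iff
   a @ net_filter le --> l. *)
Definition net_filter (I : Type) (le : I -> I -> Prop) : set_system I :=
  [set P | exists i, forall j, le i j -> P j].

Definition type_D B : Prop :=
  forall (xss : dual (dual X)) (xs : dual X),
    (0 <= ereal_inf
      [set (bipairing (canon a.1 - xss) (a.2 - xs))%:E | a in B])%E ->
    exists (I : Type) (le : I -> I -> Prop) (a : I -> X * dual X),
      [/\ directed_preorder le,
          forall i, B (a i),
          exists M, forall i, `|(a i).1| <= M /\ `|(a i).2| <= M,
          forall ys : dual X, bipairing (canon (a i).1) ys @[i --> net_filter le]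
            --> bipairing xss ys &
          (a i).2 @[i --> net_filter le] --> xs].

Definition type_BR B : Prop :=
  forall (x : X) (xs : dual X) (alpha beta : R), 0 < alpha -> 0 < beta ->
    ((- (alpha * beta))%:E <
      ereal_inf [set (pairing (x - a.1) (xs - a.2))%:E | a in B])%E ->
    exists b, [/\ B b, `|x - b.1| < alpha & `|xs - b.2| < beta].

Definition bidual_graph B : set (dual (dual X) * dual X) :=
  [set (canon a.1, a.2) | a in B].

Definition unique_operator B : Prop :=
  forall G H : set (dual (dual X) * dual X),
    maximally_monotone bipairing G -> bidual_graph B `<=` G ->
    maximally_monotone bipairing H -> bidual_graph B `<=` H -> G = H.

End operators.

Definition space_type_D (R : realType) (X : normedModType R) : Prop :=
  forall B : set (X * dual X), maximally_monotone (@pairing R X) B -> type_D B.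

(* Such a map is an isomorphism of Y onto its range. *)
Definition contains_isomorphic_copy (R : realType) (X Y : normedModType R) :
    Prop :=
  exists T : {linear Y -> X}, continuous T /\
    exists2 c : R, 0 < c & forall y, c * `|y| <= `|T y|.

(* The infinite sum converges for every y, by james_dual_cvg. *)
Definition james_op_coef (R : realType) (y : dual (james R)) (n : nat) : R :=
  - (\big[+%R/0]_(n.+1 <= i <oo) y (james_basis R i)) +
  \sum_(i < n) y (james_basis R i).

Definition james_op (R : realType) : set (james R * dual (james R)) :=
  [set a | james_one R a.2 = 0 /\
    series (fun n => james_op_coef a.2 n *: james_basis R n) @ \oo --> a.1].

Arguments james_op R : clear implicits.

(* Main.v *)
Require Import Defs.
From mathcomp Require Import all_boot all_order all_algebra.
From mathcomp Require Import all_classical all_reals all_analysis.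
From mathcomp Require Import lra ring.

Set Implicit Arguments.
Unset Strict Implicit.
Unset Printing Implicit Defensive.

Import Order.TTheory GRing.Theory Num.Theory.
Import numFieldTopology.Exports numFieldNormedType.Exports.

Local Open Scope classical_set_scope.
Local Open Scope ring_scope.

(** Write S_n(y) for the sum of the first n values y(e_i) and L(y) = <e, y>.
    Because the basis is shrinking ([james_shrinking]), S_n(y) tends to L(y), and
    the operator pairs each y such that L(y) = 0 with the sequence
    S_n(y) + S_(n+1)(y), if it lies in the James space. Multiplying by
    y(e_n) = S_(n+1)(y) - S_n(y) makes the pairing telescope: if x in the James
    space satisfies x_n = S_n(y) + S_(n+1)(y) - c, then x_n -> 0 forces
    c = 2 L(y) and <x, y> = - L(y)^2 ([james_telescope]). Everything follows
    from this identity.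

    - L(y) = 0 gives skewness, hence monotonicity, the graph being linear.
    - If (x, y) is monotonically related to the graph, the elements
      (e_n + e_(n+1), e_n^* - e_(n+1)^* ) of the graph force
      x_(n+1) - x_n = S_(n+2)(y) - S_n(y), so x has the form above; relatedness
      to (0, 0) then reads - L(y)^2 >= 0, so L(y) = 0 and (x, y) belongs to the
      graph. This is maximality.
    - The pair (-e_0, e_0^* ) has product exactly -1 against every element of
      the graph, while e_0^* stays at distance at least 1/(||e|| + 1) from the
      range of A, on which L vanishes. Taking this distance for beta, and alpha
      such that alpha beta = 2, refutes type (BR).
    - The pair (-e_0 + e, e_0^* ) has product 0 against every element of the
      graph, and the same distance estimate refutes type (D).
    - The pair (e, 0) has product 0 against the graph as well, but (e, 0) and
      (-e_0 + e, e_0^* ) are not monotonically related to each other, so they lie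
      in two different maximally monotone extensions, given by Zorn's lemma.

    For the last assertion, an isomorphic embedding T : Y -> X carries a maximally
    monotone A on Y to the maximally monotone operator T A T^* on X, and type (D)
    of T A T^* implies type (D) of A. This uses that T^* is onto and that the
    range of T, being closed, consists of all points killed by every functional
    that vanishes on it; both come from the Hahn-Banach theorem
    ([hahn_banach_graph]). *)

(** * Zorn's lemma and maximally monotone extensions *)

(** Zorn's lemma above a given set. Closure is asked under unions of nonempty
    chains only, because the union of the empty chain is not the graph of a linear
    functional. *)
Lemma maximal_superset (T : Type) (P : set (set T)) (G0 : set T) : P G0 ->
  (forall F : set (set T), F !=set0 -> F `<=` P -> total_on F subset ->
    P (\bigcup_(X in F) X)) ->
  exists A, [/\ P A, G0 `<=` A & forall B, P B -> A `<=` B -> B = A].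
Proof.
move=> PG0 Pcup.
pose Q := [set A | A = set0 \/ (P A /\ G0 `<=` A)].
have Qcup (F : set (set T)) : F `<=` Q -> total_on F subset -> Q (\bigcup_(X in F) X).
  move=> FQ Ftot; pose F' := [set A | F A /\ P A /\ G0 `<=` A].
  have [[A F'A]|F'0] := pselect (F' !=set0); last first.
    left; rewrite bigcup0// => A FA.
    by have [//|PA] := FQ _ FA; case: F'0; exists A.
  have -> : \bigcup_(X in F) X = \bigcup_(X in F') X.
    apply/seteqP; split=> x [B FB Bx]; last by exists B => //; case: FB.
    have [B0|PB] := FQ _ FB; first by rewrite B0 in Bx.
    by exists B.
  right; split.
    apply: Pcup; first by exists A.
      by move=> B [_ []].
    by move=> B C [FB _] [FC _]; exact: Ftot.
  by move=> x G0x; exists A => //; case: F'A => _ [_]; exact.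
have [A [QA Amax]] := Zorn_bigcup Qcup.
have PA : P A /\ G0 `<=` A.
  case: QA => // A0; have [G00|G0n] := pselect (G0 = set0).
    by rewrite A0 -G00; split.
  have [x G0x] : G0 !=set0 by apply/set0P/eqP.
  exfalso; apply: (Amax G0); last by right; split.
  by rewrite A0 properEneq; split=> //; apply/eqP => G00; rewrite -G00 in G0x.
case: PA => PA G0A; exists A; split=> // B PB AB; apply: contrapT => BA.
apply: (Amax B); last by right; split=> // x /G0A /AB.
by rewrite properEneq; split=> //; apply/eqP => /esym.
Qed.

Lemma maximally_monotone_extension (R : realType) (U V : zmodType)
    (p : U -> V -> R) (G : set (U * V)) :
  Defs.monotone p G -> exists2 H, maximally_monotone p H & G `<=` H.
Proof.
move=> mG.
have [|A [mA GA Amax]] := @maximal_superset _ (Defs.monotone p) G mG.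
  move=> F _ Fm Ftot a b [A FA Aa] [B FB Bb].
  have [AB|BA] := Ftot _ _ FA FB.
    by apply: (Fm _ FB) => //; exact: AB.
  by apply: (Fm _ FA) => //; exact: BA.
by exists A.
Qed.

Lemma maximally_monotone_mem (R : realType) (U V : zmodType) (p : U -> V -> R)
    (G : set (U * V)) (q : U * V) :
  (forall u v, p (- u) (- v) = p u v) -> p 0 0 = 0 ->
  maximally_monotone p G ->
  (forall a, G a -> 0 <= p (q.1 - a.1) (q.2 - a.2)) -> G q.
Proof.
move=> pN p0 [mG Gmax] qG.
rewrite -(Gmax (q |` G)); [by left| |by move=> a Ga; right].
move=> a b [->|Ga] [->|Gb]; last exact: mG.
- by rewrite !subrr p0.
- exact: qG.
- by rewrite -pN !opprB; exact: qG.
Qed.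

(** * The Hahn-Banach theorem *)

Section hahn_banach.
Context (R : realType) (X : normedModType R).

(** Partial linear functionals are represented by their graphs, which avoids
    subspace types. Domination by [C * `|x|] of a linear graph contains
    single-valuedness, since (0, r) and (0, -r) are both dominated by 0. *)
Definition linear_graph (G : set (X * R)) :=
  G (0, 0) /\ forall c a b, G a -> G b -> G (c *: a.1 + b.1, c * a.2 + b.2).

Definition dominated (C : R) (G : set (X * R)) :=
  forall a, G a -> a.2 <= C * `|a.1|.

Definition graph_extension (G : set (X * R)) (x : X) (r : R) : set (X * R) :=
  [set b | exists a t, [/\ G a, b.1 = a.1 + t *: x & b.2 = a.2 + t * r]].

Lemma graph_extension_linear (G : set (X * R)) (x : X) (r : R) :
  linear_graph G -> linear_graph (graph_extension G x r).
Proof.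
move=> [G0 Glin]; split.
  by exists (0, 0), 0; split=> //=; rewrite ?scale0r ?mul0r addr0.
move=> c [u p] [v q] [a [t [Ga /= -> ->]]] [b [s [Gb /= -> ->]]].
exists (c *: a.1 + b.1, c * a.2 + b.2), (c * t + s); split=> /=.
- exact: Glin.
- by rewrite scalerDr scalerDl scalerA addrACA.
- by ring.
Qed.

(** The value at the new point may be anything between
    [sup (a.2 - C * `|a.1 - x|)] and [inf (C * `|b.1 + x| - b.2)]; the triangle
    inequality makes this interval nonempty. *)
Lemma hahn_banach_step (C : R) (G : set (X * R)) (x : X) : 0 <= C ->
  linear_graph G -> dominated C G ->
  exists r, dominated C (graph_extension G x r).
Proof.
move=> C0 [G0 Glin] Gdom.
have GZ c a : G a -> G (c *: a.1, c * a.2).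
  by move=> Ga; have := Glin c _ _ Ga G0; rewrite /= !addr0.
pose S := [set a.2 - C * `|a.1 - x| | a in G].
have SB b : G b -> forall s, S s -> s <= C * `|b.1 + x| - b.2.
  move=> Gb _ [a Ga <-].
  have := Gdom _ (Glin 1 _ _ Ga Gb); rewrite /= scale1r mul1r.
  have : C * `|a.1 + b.1| <= C * `|b.1 + x| + C * `|a.1 - x|.
    rewrite -mulrDr ler_wpM2l//.
    have -> : a.1 + b.1 = (b.1 + x) + (a.1 - x) by rewrite addrC addrACA subrr addr0.
    exact: ler_normD.
  by lra.
have S0 : S !=set0 by exists (0 - C * `|0 - x|); exists (0, 0).
have supS : has_sup S.
  by split=> //; exists (C * `|0 + x| - 0); exact: (SB (0, 0)).
exists (sup S) => -[u p] [a [t [Ga /= -> ->]]].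
have [t0|t0|->] := ltgtP t 0; last by rewrite mul0r scale0r !addr0; exact: Gdom.
- have nt0 : 0 < - t by rewrite oppr_gt0.
  have : (- t)^-1 * a.2 - C * `|(- t)^-1 *: a.1 - x| <= sup S.
    apply: sup_upper_bound => //.
    by exists ((- t)^-1 *: a.1, (- t)^-1 * a.2) => //; exact: GZ.
  rewrite -(ler_pM2l nt0) mulrBr mulVKf ?gt_eqF// mulrCA.
  rewrite -[X in _ * (X * _)](gtr0_norm nt0) -normrZ scalerBr scalerA (@mulfV R (- t)) ?gt_eqF//.
  by rewrite scale1r scaleNr opprK; lra.
- have : sup S <= C * `|t^-1 *: a.1 + x| - t^-1 * a.2.
    by apply: ge_sup => // s Ss; apply: (SB (t^-1 *: a.1, t^-1 * a.2)) => //; exact: GZ.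
  rewrite -(ler_pM2l t0) mulrBr mulVKf ?gt_eqF// mulrCA.
  rewrite -[X in _ * (X * _)](gtr0_norm t0) -normrZ scalerDr scalerA (@mulfV R t) ?gt_eqF//.
  by rewrite scale1r; lra.
Qed.

Theorem hahn_banach_graph (C : R) (G : set (X * R)) : 0 <= C ->
  linear_graph G -> dominated C G ->
  exists f : dual X, forall a, G a -> f a.1 = a.2.
Proof.
move=> C0 Glin Gdom.
have [|F [H FH] FP Ftot|A [[Alin Adom] GA Amax]] :=
    @maximal_superset _ [set G | linear_graph G /\ dominated C G] G.
- by [].
- split; last by move=> a [B /FP[_ +] Ba]; exact.
  split; first by exists H => //; have [[]] := FP _ FH.
  move=> c a b [B FB Ba] [D FD Db].
  have [BD|DB] := Ftot _ _ FB FD.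
    by exists D => //; have [[_ Dlin] _] := FP _ FD; apply: Dlin => //; exact: BD.
  by exists B => //; have [[_ Blin] _] := FP _ FB; apply: Blin => //; exact: DB.
have Atotal x : exists r, A (x, r).
  have [r rdom] := hahn_banach_step x C0 Alin Adom; exists r.
  rewrite -(Amax (graph_extension A x r)).
  - by exists (0, 0), 1; split; [case: Alin|rewrite /= scale1r add0r|rewrite /= mul1r add0r].
  - by split=> //; exact: graph_extension_linear.
  - by move=> a Aa; exists a, 0; rewrite scale0r mul0r !addr0.
have Auniq x r s : A (x, r) -> A (x, s) -> r = s.
  move=> Ar As; case: Alin => _ Alin.
  have := Adom _ (Alin (-1) _ _ Ar As); have := Adom _ (Alin (-1) _ _ As Ar).
  by rewrite /= scaleN1r addNr normr0 mulr0; lra.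
have [f fA] := choice Atotal.
have flin : linear (f : X -> R^o).
  move=> c x z; apply: (Auniq (c *: x + z)); first exact: fA.
  by case: Alin => _ Alin; exact: (Alin c _ _ (fA x) (fA z)).
have fC x : `|f x| <= C * `|x|.
  rewrite ler_norml (Adom _ (fA x)) andbT lerNl.
  have := Adom _ (fA (- x)); rewrite /= normrN; apply: le_trans.
  have := flin (-1) x 0; rewrite addr0 scaleN1r => ->.
  rewrite (_ : f 0 = 0) ?addr0 ?scaleN1r//.
  by apply: (Auniq 0); [exact: fA|case: Alin].
exists (Dual (bounded_dual_fun flin fC)) => -[x r] Gx.
by apply: (Auniq x); [exact: fA|exact: GA].
Qed.

End hahn_banach.

(** * Pairings, infima and nets *)

(** Scaling in a linear graph turns monotone relatedness into orthogonality
    through this remark. *)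
Lemma slope_eq0 (R : realFieldType) (r s : R) :
  (forall t, 0 <= r + t * s) -> s = 0.
Proof.
move=> rs; apply/eqP; apply: contrapT => /negP s0.
by have := rs (- (r + 1) / s); rewrite divfK//; lra.
Qed.

Lemma dual_cvg (R : realType) (X : normedModType R) (f : dual X) (T : Type)
    (F : set_system T) (FF : Filter F) (u : T -> X) (l : X) :
  u @ F --> l -> (fun t => f (u t) : R) @ F --> (f l : R).
Proof. by move=> ul; exact: (cvg_comp _ _ ul (@dual_continuous _ _ f l)). Qed.

Section pairing_theory.
Context (R : realType) (X : normedModType R).

Lemma dualBE (f g : dual X) (x : X) : (f - g) x = f x - g x :> R.
Proof. by []. Qed.

Lemma pairingN (x : X) (f : dual X) : pairing (- x) (- f) = pairing x f.
Proof.
by rewrite /pairing linearN -[LHS]/(- - f x) opprK.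
Qed.

Lemma pairing00 : pairing (0 : X) 0 = 0.
Proof. by []. Qed.

Lemma pairingBB (x z : X) (f g : dual X) :
  pairing (x - z) (f - g) = f x - f z - g x + g z.
Proof.
by rewrite /pairing linearB/= -[LHS]/(f x - g x - (f z - g z)); ring.
Qed.

End pairing_theory.

Section ereal_inf_theory.
Context (R : realType) (T : Type).

Lemma le_ereal_infP (B : set T) (h : T -> R) (r : R) :
  (r%:E <= ereal_inf [set (h a)%:E | a in B])%E <-> forall a, B a -> r <= h a.
Proof.
split=> [rB a Ba|rB].
  rewrite -lee_fin; apply: (le_trans rB); apply: ereal_inf_lbound; by exists a.
by apply: le_ereal_inf_tmp => _ [a Ba <-]; rewrite lee_fin; exact: rB.
Qed.

End ereal_inf_theory.

Lemma net_filter_proper (I : Type) (le : I -> I -> Prop) :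
  directed_preorder le -> ProperFilter (net_filter le).
Proof.
move=> [[i0] lexx letrans ledir]; split.
  by move=> [i iP]; exact: (iP i (lexx i)).
split.
- by exists i0.
- move=> P Q [i iP] [j jQ]; have [k [ik jk]] := ledir i j.
  by exists k => l kl; split; [apply/iP/(letrans _ _ _ ik)|apply/jQ/(letrans _ _ _ jk)].
- by move=> P Q PQ [i iP]; exists i => j ij; apply/PQ/iP.
Qed.

(** * Transfer of operators along an isomorphic embedding *)

Section embedding.
Context (R : realType) (X : normedModType R) (Y : completeNormedModType R).
Context (T : {linear Y -> X}) (c : R) (Tcont : continuous T) (c0 : 0 < c).
Context (Tc : forall y, c * `|y| <= `|T y|).

Lemma adjoint_fun (f : dual X) : ((fun y => f (T y)) : Y -> R^o) \in dual_fun Y.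
Proof.
apply/asboolP; split; first by move=> a y z; rewrite linearP linearP.
by move=> y; apply: continuous_comp; [exact: Tcont|exact: dual_continuous].
Qed.

Definition adjoint (f : dual X) : dual Y := Dual (adjoint_fun f).

Lemma adjoint_norm : exists M, forall f, `|adjoint f| <= M * `|f|.
Proof.
have /linear_boundedP/pinfty_ex_gt0[M M0 TM] : bounded_near T (nbhs (0 : Y)).
  exact/linear_bounded_continuous.
exists M => f; apply: dual_norm_le => y y1.
rewrite mulrC (le_trans (ler_dual f (T y)))// ler_wpM2l// (le_trans (TM y))//.
by rewrite -[leRHS]mulr1 ler_wpM2l// ltW.
Qed.

Lemma adjointB (f g : dual X) : adjoint (f - g) = adjoint f - adjoint g.
Proof. exact: dual_eqP. Qed.

Lemma adjoint_surj (g : dual Y) : exists f, adjoint f = g.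
Proof.
have [| | |f fg] := @hahn_banach_graph R X (`|g| / c) [set (T y, g y : R) | y in setT].
- by rewrite divr_ge0// ltW.
- split; first by exists 0; rewrite ?linear0.
  move=> a _ _ [y _ <-] [z _ <-]; exists (a *: y + z) => //=.
  by rewrite !linearP.
- move=> _ [y _ <-] /=; rewrite mulrAC -mulrA.
  rewrite (le_trans (ler_norm _))// (le_trans (ler_dual _ _))// ler_wpM2l//.
  by rewrite mulrC ler_pdivlMl.
exists f; apply: dual_eqP => y; apply: (fg (T y, g y : R)).
by exists y.
Qed.

(** A sequence whose image converges is Cauchy, since [T] is bounded below. *)
Lemma embedding_range_closed (z : X) :
  (forall d, 0 < d -> exists y, `|z - T y| < d) -> exists y, T y = z.
Proof.
move=> zT; have [y yz] := choice (fun n => zT n.+1%:R^-1 ltac:(by rewrite invr_gt0)).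
have Ty : T \o y @ \oo --> z.
  apply/cvgrPdist_lt => e e0; near=> n.
  apply: (lt_trans (yz n)); near: n.
  exact: near_infty_natSinv_lt (PosNum e0).
have : cvg (y @ \oo).
  apply/cauchy_cvgP/cauchy_exP => e e0.
  have ce0 : 0 < c * e / 2 by rewrite divr_gt0 ?mulr_gt0.
  have /cvgrPdist_lt/(_ _ ce0)[N _ NT] := Ty.
  exists (y N); exists N => // n /= Nn; rewrite -ball_normE /=.
  have := Tc (y N - y n); rewrite linearB/=.
  have := ler_normD (T (y N) - z) (z - T (y n)); rewrite addrA subrK.
  have := NT N (leqnn N); have := NT n Nn; rewrite /= => H1 H2; rewrite [`|_ - z|]distrC => H3 H4.
  rewrite -(ltr_pM2l c0); lra.
move=> /cvg_ex[l yl]; exists l.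
apply: (@cvg_unique _ (@norm_hausdorff _ X) (T \o y @ \oo)) => //.
exact: (cvg_comp _ _ yl (@Tcont l)).
Unshelve. all: by end_near. Qed.

(** Otherwise z is at positive distance d from the range of [T], and
    T y + t z |-> t is dominated by [d^-1 * `|_|], so that it extends to a functional
    vanishing on the range of [T] but not at z. *)
Lemma embedding_range_annihilator (z : X) :
  (forall f, adjoint f = 0 -> f z = 0) -> exists y, T y = z.
Proof.
move=> zT; apply: embedding_range_closed; apply: contrapT => nz.
have [d d0 dz] : exists2 d, 0 < d & forall y, d <= `|z - T y|.
  apply: contrapT => nd; apply: nz => d d0; apply: contrapT => ny.
  apply: nd; exists d => // y; rewrite leNgt; apply/negP => yd.
  by apply: ny; exists y.
have [| | |f fT] := @hahn_banach_graph R X d^-1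
    (graph_extension [set (T y, 0 : R) | y in setT] z 1).
- by rewrite invr_ge0 ltW.
- apply: graph_extension_linear; split; first by exists 0; rewrite ?linear0.
  move=> a _ _ [y _ <-] [w _ <-]; exists (a *: y + w) => //=.
  by rewrite linearP mulr0 addr0.
- move=> [u p] [_ [t [[y _ <-] /= -> ->]]]; rewrite add0r mulr1.
  have [t0|t0] := leP t 0.
    by rewrite (le_trans t0)// mulr_ge0 ?invr_ge0 ?(ltW d0).
  rewrite ler_pdivlMl// -[X in _ <= `|X|](_ : t *: (z - T (- t^-1 *: y)) = _).
    by rewrite normrZ gtr0_norm// mulrC ler_wpM2l// ltW.
  by rewrite linearZ/= scaleNr opprK scalerDr scalerA mulfV ?gt_eqF// scale1r addrC.
have : f z = 0.
  apply: zT; apply: dual_eqP => y.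
  apply: (fT (T y, 0 : R)); exists (T y, 0), 0; split.
  - by exists y.
  - by rewrite /= scale0r addr0.
  - by rewrite /= mul0r addr0.
rewrite (fT (z, 1 : R)) /=; first by move/eqP; rewrite oner_eq0.
exists (0, 0), 1; split.
- by exists 0; rewrite ?linear0.
- by rewrite /= scale1r add0r.
- by rewrite /= mul1r add0r.
Qed.

(** The composition T A T^*. *)
Definition transfer (A : set (Y * dual Y)) : set (X * dual X) :=
  [set b | exists2 a, A a & b.1 = T a.1 /\ adjoint b.2 = a.2].

(** If (z, f) is monotonically related to [transfer A], adding to a second
    component any functional that kills the range of [T] stays in [transfer A];
    hence z is annihilated by all of them and is some T w. Then (w, T^* f) is
    monotonically related to A. *)
Lemma transfer_maximally_monotone (A : set (Y * dual Y)) :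
  maximally_monotone (@pairing R Y) A ->
  maximally_monotone (@pairing R X) (transfer A).
Proof.
move=> Amax; have [mA _] := Amax; split.
  move=> b b' [a Aa [-> ba]] [a' Aa' [-> ba']].
  have := mA _ _ Aa Aa'; rewrite -ba -ba' !pairingBB.
  exact.
move=> H mH AH; apply/seteqP; split=> // -[z f] Hzf.
have [[x0 g0] Ax0] : exists a, A a.
  apply: contrapT => nA.
  suff : A (0, 0) by move=> A0; apply: nA; exists (0, 0).
  apply: (maximally_monotone_mem (@pairingN R Y) (@pairing00 R Y) Amax).
  by move=> a Aa; case: nA; exists a.
have [f0 f0g] := adjoint_surj g0.
have [w wz] : exists w, T w = z.
  apply: embedding_range_annihilator => f1 f10.
  have f1T y : f1 (T y) = 0 by rewrite -[LHS]/(adjoint f1 y) f10.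
  apply: (@slope_eq0 _ (pairing (z - T x0) (f - f0))) => t.
  have tA : transfer A (T x0, f0 - t *: f1).
    exists (x0, g0) => //; split=> //; apply: dual_eqP => y.
    by rewrite -f0g -[LHS]/(f0 (T y) - t * f1 (T y)) f1T mulr0 subr0.
  have : 0 <= pairing (z - T x0) (f - (f0 - t *: f1)) := mH _ _ Hzf (AH _ tA).
  by rewrite !pairingBB !dualBE !dualZE f1T; lra.
exists (w, adjoint f); last by rewrite /= wz.
apply: (maximally_monotone_mem (@pairingN R Y) (@pairing00 R Y) Amax).
move=> [x g] Axg.
have [f1 f1g] := adjoint_surj g.
have xA : transfer A (T x, f1) by exists (x, g).
by have := mH _ _ Hzf (AH _ xA); rewrite !pairingBB /= -wz -f1g.
Qed.

(** A pair (x**, x* ) for A lifts to (T** x**, f) with T^* f = x*, and the net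
    obtained for [transfer A] comes back along T^-1 and T^*. *)
Lemma transfer_type_D (A : set (Y * dual Y)) :
  type_D (transfer A) -> type_D A.
Proof.
move=> TD xss xs /le_ereal_infP infA.
have bc : ((fun f : dual X => xss (adjoint f)) : dual X -> R^o) \in dual_fun (dual X).
  have [M adjM] := adjoint_norm.
  apply: (@bounded_dual_fun _ _ _ (`|xss| * M)) => [a f g|f].
    have -> : adjoint (a *: f + g) = a *: adjoint f + adjoint g by exact: dual_eqP.
    by rewrite linearP.
  by rewrite (le_trans (ler_dual _ _))// -mulrA ler_wpM2l.
have [fs fsE] := adjoint_surj xs.
have [|I [le [b [dir Bb [M bM] bw bs]]]] := TD (Dual bc) fs.
  apply/le_ereal_infP => -[_ g] [[y h] Ayh [/= -> gh]].
  have := infA _ Ayh; rewrite /bipairing /= -gh -fsE -adjointB.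
  exact.
have FF := net_filter_proper dir.
have {}Bb i : exists a, A a /\ (b i).1 = T a.1 /\ adjoint (b i).2 = a.2.
  by have [a Aa ba] := Bb i; exists a.
have [a aP] := choice Bb.
exists I, le, (fun i => ((a i).1, adjoint (b i).2)).
have [N adjN] := adjoint_norm.
split.
- by [].
- move=> i; have [Aa [_ ->]] := aP i; by case: (a i) Aa.
- exists (Num.max (M / c) (`|N| * M)) => i; have [Aa [b1 b2]] := aP i.
  have [M1 M2] := bM i; rewrite !le_max ler_pdivlMr// mulrC; split.
    by rewrite (le_trans (Tc _)) ?orTb// -b1.
  apply/orP; right; rewrite (le_trans (adjN _))// (@le_trans _ _ (`|N| * `|(b i).2|))//.
    by rewrite ler_wpM2r// ler_norm.
  by rewrite ler_wpM2l.
- move=> g; have [f fg] := adjoint_surj g.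
  have := bw f; rewrite /bipairing /= fg.
  have -> : (fun i => f (b i).1) = (fun i => g (a i).1) :> (I -> R^o).
    by apply/funext => i; have [_ [-> _]] := aP i; rewrite -fg.
  exact.
- apply/cvgrPdist_lt => e e0.
  have N0 : 0 < `|N| + 1 by rewrite ltr_wpDl.
  have eN : 0 < e / (`|N| + 1) by rewrite divr_gt0.
  have /cvgrPdist_lt/(_ _ eN)[i iP] := bs.
  exists i => j /iP; rewrite ltr_pdivlMr// => ij /=.
  rewrite -fsE -adjointB (le_lt_trans (adjN _))// (le_lt_trans _ ij)//.
  by rewrite mulrC ler_wpM2l// (le_trans (ler_norm _))// lerDl.
Qed.

End embedding.

Theorem space_type_D_embedding (R : realType) (X : normedModType R)
    (Y : completeNormedModType R) :
  contains_isomorphic_copy X Y -> space_type_D X -> space_type_D Y.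
Proof.
move=> [T [Tcont [c c0 Tc]]] XD A Amax.
apply: (@transfer_type_D _ _ _ _ _ Tcont c0 Tc).
by apply: XD; exact: (transfer_maximally_monotone Tcont c0 Tc).
Qed.

(** * The basis of the James space is shrinking *)

Section james_basis_theory.
Context (R : realType).
Implicit Types (x u v z : james R) (y : dual (james R)).

Lemma james_var_cons2 (f : nat -> R^o) a b s :
  james_var f [:: a, b & s] = (f a - f b) ^+ 2 + james_var f (b :: s).
Proof. by rewrite /james_var/= big_nat_recl. Qed.

Lemma james_var1 (f : nat -> R^o) a : james_var f [:: a] = 0.
Proof. by rewrite /james_var/= big_nil. Qed.

Lemma eq_james_var (f g : nat -> R^o) a s :
  (forall i, (a <= i)%N -> f i = g i) -> path ltn a s ->
  james_var f (a :: s) = james_var g (a :: s).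
Proof.
elim: s a => [|b s ih] a fg /=; first by rewrite !james_var1.
case/andP => ab bs; rewrite !james_var_cons2 !fg ?(ltnW ab)// ih// => i bi.
by rewrite fg// (leq_trans (ltnW ab)).
Qed.

Lemma james_var_cat (f : nat -> R^o) s t :
  james_var f s + james_var f t <= james_var f (s ++ t).
Proof.
elim: s => [|a [|b s] ih].
- by rewrite {1}/james_var big_nil add0r.
- rewrite james_var1 add0r; case: t {ih} => [|b t]; first by rewrite james_var1 /james_var big_nil.
  by rewrite james_var_cons2 lerDr sqr_ge0.
- by rewrite /= !james_var_cons2 -addrA lerD2l.
Qed.

(** Two consecutive blocks interact only through the single step that crosses
    from one to the other, and (p - q)^2 <= 2 p^2 + 2 q^2. Including the term
    [2 * g b ^+ 2] in the bound for the right block pays in advance for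
    that step, so that the bound can be iterated over many blocks. *)
Lemma james_var_glue (f g h : nat -> R^o) M (B D : R) :
  (forall i, (i < M)%N -> h i = f i) ->
  (forall i, (M <= i)%N -> h i = g i) ->
  (forall i, (i < M)%N -> f i ^+ 2 <= B) ->
  (forall b t, (M <= b)%N -> path ltn b t ->
    james_var g (b :: t) + 2 * g b ^+ 2 <= D) ->
  forall a s, (a < M)%N -> path ltn a s ->
    james_var h (a :: s) <= james_var f (a :: s) + 2 * B + D.
Proof.
move=> hf hg fB gD a s aM.
have D0 : 0 <= D.
  have := gD M [::] (leqnn M) isT; rewrite james_var1 add0r.
  by apply: le_trans; rewrite mulr_ge0 ?sqr_ge0.
have B0 : 0 <= B by apply: le_trans (fB _ aM); exact: sqr_ge0.
elim: s a aM => [|b s ih] a aM /=; first by rewrite !james_var1; lra.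
case/andP => ab bs; rewrite !james_var_cons2 (hf a)//.
have [bM|Mb] := ltnP b M.
  by have := ih b bM bs; rewrite (hf b)//; lra.
rewrite (hg b)// (@eq_james_var h g)//; last first.
  by move=> i bi; rewrite hg// (leq_trans Mb).
have := gD b s Mb bs; have := fB a aM.
have := sqr_ge0 (f a - f b); have := james_var_ge0 f (b :: s).
have := sqr_ge0 (f a + g b).
by rewrite !expr2; nra.
Qed.

Lemma james_var_le_normsq x s : sorted ltn s -> james_var x s <= `|x| ^+ 2.
Proof.
move=> /(james_var_norm x); rewrite -(ler_sqr _ (normr_ge0 x)) ?nnegrE ?sqrtr_ge0//.
by rewrite sqr_sqrtr ?james_var_ge0.
Qed.

Lemma james_normsq_le x (D : R) : 0 <= D ->
  (forall a s, path ltn a s -> james_var x (a :: s) <= D) -> `|x| ^+ 2 <= D.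
Proof.
move=> D0 xD; rewrite -[leRHS]sqr_sqrtr// ler_sqr ?nnegrE ?sqrtr_ge0//.
apply: james_norm_leP => -[|a s] ss; rewrite ler_wsqrtr//; last exact: xD.
by rewrite /james_var big_nil.
Qed.

Definition james_head (N : nat) x : james R :=
  series (fun n => x n *: james_basis R n) N.

Lemma james_basisE n i : james_basis R n i = (i == n)%:R.
Proof. by []. Qed.

Lemma james_seriesE (c : nat -> R) N i :
  series (fun n => c n *: james_basis R n : james R) N i = if (i < N)%N then c i else 0.
Proof.
rewrite /series/=; elim: N => [|N ih]; first by rewrite big_nil.
rewrite big_nat_recr//= -[LHS]/(james_val _ i + c N * james_basis R N i) ih.
rewrite james_basisE ltnS.
case: ltngtP => iN; rewrite ?mulr0 ?addr0 ?mulr1 ?add0r//.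
by rewrite iN.
Qed.

Lemma james_tailE N x i : (x - james_head N x) i = if (i < N)%N then 0 else x i.
Proof.
rewrite jamesBE james_seriesE; case: ifP => _; first exact: subrr.
exact: subr0.
Qed.

Lemma james_tail_normsq_le N x (D : R) :
  (forall b t, (N <= b)%N -> path ltn b t ->
    james_var x (b :: t) + 2 * x b ^+ 2 <= D) ->
  `|x - james_head N x| ^+ 2 <= D.
Proof.
move=> xD.
have D0 : 0 <= D.
  have := xD N [::] (leqnn N) isT; rewrite james_var1 add0r.
  by apply: le_trans; rewrite mulr_ge0 ?sqr_ge0.
apply: james_normsq_le => // a s pas.
have [aN|Na] := ltnP a N; last first.
  rewrite (@eq_james_var _ x)//; first by have := xD _ _ Na pas; have := sqr_ge0 (x a); lra.
  by move=> i ai; rewrite james_tailE ltnNge (leq_trans Na ai).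
rewrite (le_trans (@james_var_glue (fun=> 0) x _ N 0 D _ _ _ _ a s aN pas))//.
- by move=> i iN; rewrite james_tailE iN.
- by move=> i; rewrite james_tailE leqNgt => /negbTE ->.
- by move=> i _; rewrite expr0n.
- rewrite /james_var big1 ?mulr0 ?add0r// => i _.
  by rewrite oppr0 expr0n.
Qed.

Lemma james_tail_norm_le N x : `|x - james_head N x| <= 2 * `|x|.
Proof.
rewrite -ler_sqr ?nnegrE ?mulr_ge0//.
have : `|x - james_head N x| ^+ 2 <= 3 * `|x| ^+ 2.
  apply: james_tail_normsq_le => b t _ pbt.
  have := @james_var_le_normsq x (b :: t) pbt.
  have : x b ^+ 2 <= `|x| ^+ 2.
    by rewrite -[x b ^+ 2]real_normK ?num_real// ler_sqr ?nnegrE// ler_james_coord.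
  lra.
by have := sqr_ge0 `|x|; rewrite exprMn; lra.
Qed.

(** If a finite sequence s nearly realises the norm of x, then beyond the last
    index of s there is almost no variation left, because variations on
    consecutive index sequences add up. *)
Lemma james_head_cvg x : james_head^~ x @ \oo --> x.
Proof.
apply/cvgrPdist_le => e e0.
pose d := e ^+ 2 / 3.
have d0 : 0 < d by rewrite divr_gt0 ?exprn_gt0.
have [s ss sd] : exists2 s, sorted ltn s & `|x| ^+ 2 - d < james_var x s.
  apply: contrapT => ns.
  have xs s : sorted ltn s -> james_var x s <= `|x| ^+ 2 - d.
    by move=> ss; rewrite leNgt; apply/negP => xs; apply: ns; exists s.
  have : `|x| ^+ 2 <= `|x| ^+ 2 - d.
    apply: james_normsq_le => [|a t pat]; last exact: xs.
    by have := xs [::] isT; rewrite /james_var big_nil.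
  by lra.
have : \forall N \near \oo, forall b, (N <= b)%N -> x b ^+ 2 <= d.
  have d1 : 0 < Num.sqrt d by rewrite sqrtr_gt0.
  have /cvgr0Pnorm_le/(_ _ d1)[N _ Nd] := @james_cvg0 _ x.
  exists N => // n /= Nn b nb; rewrite -[leRHS]sqr_sqrtr ?(ltW d0)//.
  rewrite -[x b ^+ 2]real_normK ?num_real// ler_sqr ?nnegrE ?sqrtr_ge0//.
  exact/Nd/(leq_trans Nn).
move=> xd; near=> N.
rewrite -ler_sqr ?nnegrE ?(ltW e0)//; apply: james_tail_normsq_le => b t Nb pbt.
have st : sorted ltn (s ++ b :: t).
  have : (last 0 s < N)%N by near: N; exact: nbhs_infty_gt.
  move=> /leq_trans /(_ Nb); case: (s) ss => //= a s' pas sb.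
  by rewrite cat_path pas /= sb.
have xb : x b ^+ 2 <= d.
  by move: b Nb {pbt st}; near: N.
have := james_var_le_normsq x st; have := james_var_cat x s (b :: t).
by move: sd xb; rewrite /d; lra.
Unshelve. all: by end_near. Qed.


Lemma james_dual_headE y N x :
  y (james_head N x) = \sum_(0 <= i < N) x i * y (james_basis R i).
Proof.
rewrite /james_head /series/= linear_sum; apply: eq_bigr => i _.
by rewrite linearZ.
Qed.

Lemma james_coord_seriesE (c : nat -> R) N x :
  series (fun n => c n *: james_coord R n : dual (james R)) N x =
  \sum_(0 <= i < N) x i * c i.
Proof.
rewrite /series/=; elim: N => [|N ih]; first by rewrite !big_nil.
by rewrite !big_nat_recr//= -[LHS]/(dual_val _ x + c N * x N) ih [c N * _]mulrC.
Qed.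

(** Sums of K consecutive blocks of bounded norm have norm O(sqrt K), whereas y
    grows linearly on them. The constant 80 is 16 + 2 * 16 + 2 * 16: the
    variation of a block of norm at most 4, its half of the crossing step, and the term
    reserved for the crossing from the block before it. *)
Lemma james_dual_blocks y (e : R) : 0 < e ->
  (forall N, exists u M, [/\ forall i, (i < N)%N -> u i = 0,
     forall i, (M <= i)%N -> u i = 0, `|u| <= 4 & e <= y u]) ->
  forall K N, exists z, [/\ forall i, (i < N)%N -> z i = 0,
    forall a s, path ltn a s ->
      james_var z (a :: s) + 2 * z a ^+ 2 <= K%:R * 80 &
    K%:R * e <= y z].
Proof.
move=> e0 block; elim=> [|K ih] N.
  exists 0; split=> //; last by rewrite mul0r linear0.
  move=> a s _; rewrite mul0r expr0n mulr0 addr0 /james_var big1// => i _.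
  by rewrite subrr expr0n.
have [u [M [uN uM u4 yu]]] := block N.
have [v [vM vK yv]] := ih (maxn M N).
exists (u + v); split.
- move=> i iN; rewrite jamesDE uN// vM ?add0r//.
  by rewrite (leq_trans iN)// leq_maxr.
- move=> a s pas.
  have u16 : `|u| ^+ 2 <= 16.
    have -> : 16 = 4 ^+ 2 :> R by rewrite expr2; lra.
    by rewrite ler_sqr ?nnegrE.
  have ui i : u i ^+ 2 <= 16.
    apply: le_trans u16.
    by rewrite -[u i ^+ 2]real_normK ?num_real// ler_sqr ?nnegrE// ler_james_coord.
  have uv i : (i < maxn M N)%N -> (u + v) i = u i.
    by move=> iM; rewrite jamesDE vM// addr0.
  have uv' i : (maxn M N <= i)%N -> (u + v) i = v i.
    move=> Mi; rewrite jamesDE uM ?add0r//.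
    by rewrite (leq_trans _ Mi)// leq_maxl.
  rewrite -natr1.
  have [aM|Ma] := ltnP a (maxn M N); last first.
    rewrite uv'// (@eq_james_var _ v)//; last first.
      by move=> i ai; rewrite uv'// (leq_trans Ma).
    by have := vK a s pas; lra.
  have := @james_var_glue u v (u + v) _ 16 (K%:R * 80) uv uv'
    (fun i _ => ui i) (fun b t _ => vK b t) a s aM pas.
  have := @james_var_le_normsq u (a :: s) pas; have := ui a.
  by rewrite uv//; lra.
- by rewrite linearD -natr1 mulrDl mul1r addrC lerD.
Qed.

(** Otherwise there are blocks of bounded norm, arbitrarily far out, on which y is
    at least e; [james_dual_blocks] gives K e <= ||y|| sqrt(80 K) for all K. *)
Lemma james_dual_tail y (e : R) : 0 < e ->
  \forall N \near \oo, forall x, `|y (x - james_head N x)| <= e * `|x|.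
Proof.
move=> e0; apply: contrapT => nN.
have block N : exists u M, [/\ forall i, (i < N)%N -> u i = 0,
    forall i, (M <= i)%N -> u i = 0, `|u| <= 4 & e <= y u].
  have [n [x [Nn ex]]] : exists n x, (N <= n)%N /\
      e * `|x| < `|y (x - james_head n x)|.
    apply: contrapT => nx; apply: nN; exists N => // n /= Nn x.
    by rewrite leNgt; apply/negP => ex; apply: nx; exists n, x.
  have x0 : 0 < `|x|.
    rewrite normr_gt0; apply: contraTneq ex => ->.
    rewrite normr0 mulr0 -leNgt (_ : _ - _ = 0) ?linear0 ?normr0//.
    by apply: james_eqP => i; rewrite james_tailE; case: ifP.
  have [M nM yM] : exists2 M, (n <= M)%N &
      e * `|x| < `|y (james_head M x - james_head n x)|.
    have yc : (fun M => `|y (james_head M x - james_head n x)|) @ \oo -->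
        `|y (x - james_head n x)|.
      apply: cvg_norm.
      apply: dual_cvg.
      by apply: cvgB; [exact: james_head_cvg|exact: cvg_cst].
    have yM := cvgr_gt _ yc _ ex.
    have : \forall M \near \oo, (n <= M)%N /\
        e * `|x| < `|y (james_head M x - james_head n x)|.
      near=> M; split; near: M; first exact: nbhs_infty_ge.
      exact: yM.
    by case/filter_ex => M [nM eM]; exists M.
  set w := james_head M x - james_head n x in yM.
  have wE : w = (x - james_head n x) - (x - james_head M x).
    by rewrite opprB [RHS]addrC addrA subrK.
  have w4 : `|w| <= 4 * `|x|.
    rewrite wE (le_trans (ler_normB _ _))//.
    by have := james_tail_norm_le n x; have := james_tail_norm_le M x; lra.
  have wi i : w i = (x - james_head n x) i - (x - james_head M x) i.
    by rewrite wE.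
  exists ((Num.sg (y w) / `|x|) *: w), M; split.
  - move=> i iN; rewrite jamesZE wi !james_tailE (leq_trans iN Nn).
    by rewrite (leq_trans (leq_trans iN Nn) nM) subrr mulr0.
  - move=> i Mi; rewrite jamesZE wi !james_tailE !ltnNge Mi (leq_trans nM Mi)/=.
    by rewrite subrr mulr0.
  - rewrite normrZ normrM normfV normr_id normr_sg mulrAC ler_pdivrMr//.
    by case: (y w != 0); rewrite ?mul1r// mul0r mulr_ge0.
  - rewrite linearZ/= -[X in _ <= X]/(_ * y w) mulrAC -normrEsg ler_pdivlMr//.
    exact: ltW.
have bnd K : K%:R * e ^+ 2 <= 80 * `|y| ^+ 2.
  have [z [_ zK yz]] := james_dual_blocks e0 block K 0%N.
  have [->|K0] := eqVneq K 0%N; first by rewrite mul0r mulr_ge0 ?sqr_ge0.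
  have K0' : (0 : R) < K%:R by rewrite ltr0n lt0n.
  rewrite -(ler_pM2l K0').
  have z2 : `|z| ^+ 2 <= K%:R * 80.
    apply: james_normsq_le => [|a s pas]; first by rewrite mulr_ge0 ?ler0n.
    by have := zK a s pas; have := sqr_ge0 (z a); lra.
  have : K%:R * e <= `|y| * `|z|.
    by rewrite (le_trans yz)// (le_trans (ler_norm _))// ler_dual.
  move=> /(lerXn2r 2); rewrite ?nnegrE ?mulr_ge0 ?ler0n ?normr_ge0 ?(ltW e0)//.
  move=> /(_ isT isT); rewrite !exprMn => KE.
  have : `|y| ^+ 2 * `|z| ^+ 2 <= `|y| ^+ 2 * (K%:R * 80).
    by rewrite ler_wpM2l ?sqr_ge0.
  by lra.
have e20 : 0 < e ^+ 2 by rewrite exprn_gt0.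
have := bnd (Num.bound (80 * `|y| ^+ 2 / e ^+ 2)).
rewrite leNgt => /negP; apply; rewrite -ltr_pdivrMr//.
apply: archi_boundP; apply: divr_ge0; last exact: ltW.
by apply: mulr_ge0 => //; exact: sqr_ge0.
Unshelve. all: by end_near. Qed.

Lemma james_shrinking y :
  series (fun n => y (james_basis R n) *: james_coord R n : dual (james R)) @ \oo
    --> y.
Proof.
apply/cvgrPdist_le => e e0; near=> N.
have yN : forall x, `|y (x - james_head N x)| <= e * `|x|.
  by near: N; exact: james_dual_tail.
apply: dual_norm_le => x x1.
have -> : (y - series (fun n => y (james_basis R n) *: james_coord R n) N) x =
    y (x - james_head N x).
  by rewrite linearB/= james_dual_headE -james_coord_seriesE.
apply: (le_trans (yN x)); rewrite -[leRHS]mulr1 ler_wpM2l// ltW.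
Unshelve. all: by end_near. Qed.

(** Only the values of [james_one] on the coordinate functionals are known; since
    these span a dense subspace, they determine it. *)
Lemma james_one_cvg y : (fun N => y (james_step R N)) @ \oo --> james_one R y.
Proof.
have -> : (fun N => y (james_step R N)) = (fun N => james_one R
    (series (fun n => y (james_basis R n) *: james_coord R n : dual (james R)) N)).
  apply/funext => N; rewrite james_dual_step /series/= linear_sum.
  by apply: eq_bigr => i _; rewrite linearZ/= james_oneE -[RHS]/(_ * _) mulr1.
apply: dual_cvg.
exact: james_shrinking.
Qed.

End james_basis_theory.

(** * The operator *)

Section james_operator.
Context (R : realType).
Implicit Types (x : james R) (y : dual (james R)).
Local Notation one := (james_one R).
Local Notation step := (james_step R).
Local Notation coord := (james_coord R).

Lemma james_dual_basisE y n : y (james_basis R n) = y (step n.+1) - y (step n) :> R.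
Proof.
rewrite !james_dual_step !seriesEnat /= big_nat_recr//=.
by rewrite [X in X - _]addrC addrK.
Qed.

Lemma james_op_coefE y n :
  james_op_coef y n = y (step n.+1) + y (step n) - one y.
Proof.
rewrite /james_op_coef.
have -> : \big[+%R/0]_(n.+1 <= i <oo) y (james_basis R i) = one y - y (step n.+1).
  have yc : (fun N => y (step N) - y (step n.+1) : R) @ \oo --> (one y - y (step n.+1) : R).
    by apply: cvgB; [exact: james_one_cvg|exact: cvg_cst].
  apply/cvg_lim => //; apply: cvg_trans yc; apply: near_eq_cvg; near=> N.
  rewrite !james_dual_step sub_series_geq//.
  by near: N; exact: nbhs_infty_ge.
have -> : \sum_(i < n) y (james_basis R i) = y (step n).
  by rewrite james_dual_step seriesEord.
by rewrite opprB addrAC.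
Unshelve. all: by end_near. Qed.

Lemma james_opP x y : james_op R (x, y) <->
  one y = 0 /\ forall n, x n = y (step n.+1) + y (step n) :> R.
Proof.
rewrite /james_op /=; split=> -[y0].
  move=> xc; split=> // n.
  have xn : (fun N => coord n
      (series (fun n => james_op_coef y n *: james_basis R n) N)) @ \oo --> (x n : R).
    exact: (dual_cvg (f := coord n)) xc.
  rewrite -(cvg_lim _ xn)//; apply/cvg_lim => //.
  apply: cvg_near_cst; exists n.+1 => // N /= nN.
  by rewrite [LHS]james_seriesE nN james_op_coefE y0 subr0.
move=> xE; split=> //.
have := @james_head_cvg _ x; rewrite /james_head.
have -> : (fun n => x n *: james_basis R n) = (fun n => james_op_coef y n *: james_basis R n).
  by apply/funext => n; rewrite james_op_coefE y0 subr0 xE.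
exact.
Qed.

(** On the first N terms the product telescopes to S_N^2 - c S_N, where S_N is
    [y (step N)]. *)
Lemma james_telescope x y (c : R) :
  (forall n, x n = y (step n.+1) + y (step n) - c :> R) ->
  c = 2 * one y /\ y x = - one y ^+ 2 :> R.
Proof.
move=> xE.
have yc := @james_one_cvg _ y.
have cE : c = 2 * one y.
  have x0 : (fun n => x n : R) @ \oo --> (one y + one y - c : R).
    rewrite (_ : (fun n => _) = (fun n => y (step n.+1) + y (step n) - c)); last first.
      by apply/funext => n; rewrite xE.
    apply: cvgB; last exact: cvg_cst.
    apply: cvgD; last exact: yc.
    by have := yc; rewrite -(cvg_shiftS (fun n => y (step n))).
  have : one y + one y - c = 0.
    by rewrite -(cvg_lim _ x0)//; apply/cvg_lim => //; exact: james_cvg0.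
  by move=> /eqP; rewrite subr_eq0 => /eqP <-; ring.
split=> //.
have headE N : y (james_head N x) = y (step N) ^+ 2 - c * y (step N) :> R.
  elim: N => [|N ih].
    rewrite james_dual_headE big_nil.
    by rewrite /james_step big_nil linear0 expr0n mulr0 subrr.
  rewrite james_dual_headE big_nat_recr//= -james_dual_headE ih.
  rewrite xE james_dual_basisE; ring.
have yx : (fun N => y (james_head N x) : R) @ \oo --> (y x : R).
  exact: (dual_cvg (f := y)) (@james_head_cvg _ x).
have yx' : (fun N => y (james_head N x) : R) @ \oo --> (one y * one y - c * one y : R).
  rewrite (_ : (fun n => _) = (fun N => y (step N) * y (step N) - c * y (step N))); last first.
    by apply/funext => n; rewrite headE expr2.
  by apply: cvgB; apply: cvgM => //; exact: cvg_cst.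
have : y x = one y * one y - c * one y :> R.
  by rewrite -(cvg_lim _ yx)//; exact/cvg_lim.
by move=> ->; rewrite cE; ring.
Qed.

Lemma james_op_skew : skew_operator (james_op R).
Proof.
move=> [x y] /james_opP[y0 xE]; rewrite /pairing /=.
have [|_ ->] := @james_telescope x y 0; last by rewrite y0 expr0n oppr0.
by move=> n; rewrite subr0.
Qed.

Lemma james_op0 : james_op R (0, 0).
Proof.
apply/james_opP; split; first by rewrite linear0.
by move=> n; rewrite -[RHS]/(0 + 0) addr0.
Qed.

Lemma james_op_lin (c : R) a b : james_op R a -> james_op R b ->
  james_op R (c *: a.1 + b.1, c *: a.2 + b.2).
Proof.
case: a b => [x y] [x' y'] /james_opP[y0 xE] /james_opP[y'0 xE']; apply/james_opP.
split=> [|n] /=.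
  have -> : one (c *: y + y') = c * one y + one y' by exact: linearP.
  by rewrite y0 y'0 mulr0 addr0.
rewrite -[LHS]/(c * x n + x' n) -[RHS]/((c * y _ + y' _) + (c * y _ + y' _)).
by rewrite xE xE'; ring.
Qed.

Lemma james_op_monotone : Defs.monotone (@pairing R (james R)) (james_op R).
Proof.
move=> a b Aa Ab.
have := james_op_skew (james_op_lin (-1) Ab Aa).
by rewrite /= !scaleN1r ![- _ + _]addrC => ->.
Qed.

Lemma james_step_coord n m : coord n (step m) = (n < m)%N%:R :> R.
Proof. exact: james_stepE. Qed.

(** The partial sums of e_n^* - e_(n+1)^* are 1 at n+1 and 0 elsewhere. *)
Lemma james_op_test n : james_op R
  (james_basis R n + james_basis R n.+1, coord n - coord n.+1).
Proof.
apply/james_opP; split; first by rewrite linearB/= !james_oneE subrr.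
move=> i; rewrite jamesDE !james_basisE !dualBE !james_step_coord !ltnS.
have [lin|nin|->] := ltngtP i n; last first.
- by rewrite ltn_eqF// [(n.+1 < n)%N]ltnNge leqnSn /=; ring.
- case: (ltngtP i n.+1) nin => //= _ _; ring.
- by rewrite ltn_eqF 1?(ltn_trans lin)// [(n.+1 < i)%N]ltnNge ltnW ?(ltn_trans lin)//=; ring.
Qed.

Lemma james_op_related_eq0 x y (a : james R * dual (james R)) :
  (forall b, james_op R b -> 0 <= pairing (x - b.1) (y - b.2)) ->
  james_op R a -> y a.1 + a.2 x = 0 :> R.
Proof.
move=> xyA Aa; apply: (@slope_eq0 _ (y x)) => t.
have Ata : james_op R ((- t) *: a.1, (- t) *: a.2).
  by have := james_op_lin (- t) Aa james_op0; rewrite !addr0.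
have Askew : ((- t) *: a.2) ((- t) *: a.1) = 0 :> R := james_op_skew Ata.
have : 0 <= pairing (x - (- t) *: a.1) (y - (- t) *: a.2) := xyA _ Ata.
by rewrite pairingBB Askew dualZE linearZ/= -[_ *: y a.1]/(_ * y a.1); lra.
Qed.

Lemma james_op_maximally_monotone :
  maximally_monotone (@pairing R (james R)) (james_op R).
Proof.
split; first exact: james_op_monotone.
move=> H mH AH; apply/seteqP; split=> // -[x y] Hxy.
have xyA b : james_op R b -> 0 <= pairing (x - b.1) (y - b.2).
  by move=> Ab; exact: mH (x, y) b Hxy (AH _ Ab).
(* From orthogonality to e_n + e_(n+1) paired with e_n^* - e_(n+1)^*. *)
have xS n : x n.+1 = x n + (y (step n.+2) - y (step n)) :> R.
  have := james_op_related_eq0 xyA (james_op_test n).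
  rewrite /= linearD/= !james_dual_basisE.
  by rewrite -[(_ - _) x]/(x n - x n.+1) => E; lra.
pose c : R := y (step 1) + y (step 0) - x 0.
have xE n : x n = y (step n.+1) + y (step n) - c :> R.
  by elim: n => [|n ih]; [rewrite /c|rewrite xS ih]; ring.
(* Now relatedness to (0, 0) reads 0 <= - L(y)^2. *)
have [cE yx] := james_telescope xE.
have y0 : one y = 0.
  have := xyA _ james_op0; rewrite /= !subr0 /pairing yx oppr_ge0 => y0.
  by apply/eqP; rewrite -sqrf_eq0 eq_le y0 sqr_ge0.
apply/james_opP; split=> // n.
by rewrite xE cE y0 mulr0 subr0.
Qed.

(** For (x, y) in the graph the product is -1 + y(e_0) - x_0 + <x, y>, where
    x_0 = S_1(y) + S_0(y) = y(e_0) and <x, y> = 0. *)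
Lemma james_gap_pairing a : james_op R a ->
  (coord 0 - a.2) (- james_basis R 0 - a.1) = - 1 :> R.
Proof.
case: a => x y Aa; have := james_op_skew Aa; rewrite /pairing /= => yx.
have [y0 xE] := (james_opP x y).1 Aa.
rewrite -[LHS]/((- james_basis R 0 0 - x 0) - y (- james_basis R 0 - x)).
rewrite linearB linearN/= yx james_dual_basisE xE.
have -> : y (step 0) = 0 :> R by rewrite /james_step big_nil linear0.
by ring.
Qed.

(** [james_one] is 1 at e_0^* and 0 at y. *)
Lemma james_gap_far y : one y = 0 -> (`|one| + 1)^-1 <= `|coord 0 - y|.
Proof.
move=> y0; rewrite -[leLHS]mul1r ler_pdivrMr ?ltr_wpDl//.
have E : one (coord 0 - y) = 1 :> R by rewrite linearB/= james_oneE y0 subr0.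
rewrite -[leLHS]E (le_trans (ler_norm _))// (le_trans (ler_dual _ _))// mulrC.
by rewrite ler_wpM2l// lerDl.
Qed.

Lemma james_op_not_BR : ~ type_BR (james_op R).
Proof.
have N0 : 0 < `|one| + 1 by rewrite ltr_wpDl.
move=> /(_ (- james_basis R 0) (coord 0) (2 * (`|one| + 1)) (`|one| + 1)^-1).
rewrite invr_gt0 mulr_gt0// => /(_ isT N0); rewrite mulfK ?gt_eqF// => BR.
have [|[x y] [/james_opP[y0 _] _ /= xy]] := BR.
  apply: (@lt_le_trans _ _ (-1)%:E); first by rewrite lte_fin; lra.
  by apply/le_ereal_infP => a Aa; rewrite /pairing james_gap_pairing.
by move: xy; rewrite ltNge (james_gap_far y0).
Qed.

Lemma james_gap_bipairing a : james_op R a ->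
  bipairing (Defs.canon a.1 - (Defs.canon (- james_basis R 0) + one)) (a.2 - coord 0) = 0.
Proof.
move=> Aa; have [y0 _] : one a.2 = 0 /\ True by case: a Aa => x y /james_opP[].
rewrite /bipairing; set f := a.2 - coord 0.
rewrite -[LHS]/(f a.1 - (f (- james_basis R 0) + one f)).
have E : f (- james_basis R 0) - f a.1 = 1 :> R.
  have := james_gap_pairing Aa; rewrite -(opprB a.2) -/f => /eqP.
  rewrite -[X in X == _]/(- f (- james_basis R 0 - a.1)) eqr_opp => /eqP <-.
  exact/esym/(linearB (dual_val f)).
have -> : one f = - 1 by rewrite linearB/= y0 james_oneE sub0r.
by rewrite opprB addrCA -[f a.1 - _]opprB E subrr.
Qed.

Lemma james_op_not_type_D : ~ type_D (james_op R).
Proof.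
move=> /(_ (Defs.canon (- james_basis R 0) + one) (coord 0)).
case; first by apply/le_ereal_infP => a /james_gap_bipairing ->.
move=> I [le [a [dir Aa _ _ acvg]]].
have FF := net_filter_proper dir.
have N0 : 0 < (`|one| + 1)^-1 by rewrite invr_gt0 ltr_wpDl.
have /cvgrPdist_lt/(_ _ N0)[i ai] := acvg.
have [_ lexx _ _] := dir.
have := Aa i; case: (a i) (ai i (lexx i)) => x y /= xy /james_opP[y0 _].
by move: xy; rewrite ltNge (james_gap_far y0).
Qed.

Lemma james_op_not_unique : ~ unique_operator (james_op R).
Proof.
set B := bidual_graph (james_op R).
have bN (u : dual (dual (james R))) v : bipairing (- u) (- v) = bipairing u v.
  exact: pairingN.
have ext q : (forall a, james_op R a ->
    bipairing (Defs.canon a.1 - q.1) (a.2 - q.2) = 0) ->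
    exists H, [/\ maximally_monotone (@bipairing R (james R)) H, B `<=` H & H q].
  move=> qB; have [|H Hmax GH] := @maximally_monotone_extension _ _ _
      (@bipairing R (james R)) (q |` B).
    move=> a b [->|[a' Aa <-]] [->|[b' Ab <-]].
    - by rewrite !subrr.
    - by rewrite -bN !opprB (qB b' Ab).
    - by rewrite (qB a' Aa).
    - by have := james_op_monotone Aa Ab; rewrite /pairing linearB.
  exists H; split=> //; first by move=> b Bb; apply: GH; right.
  by apply: GH; left.
have [|H1 [H1max BH1 H1q]] := ext (one, 0).
  move=> [x y] Aa; have [y0 _] := (james_opP x y).1 Aa.
  have := james_op_skew Aa; rewrite /pairing /bipairing /= subr0 => yx.
  by rewrite -[LHS]/(y x - one y) yx y0 subrr.
have [|H2 [H2max BH2 H2q]] := ext (Defs.canon (- james_basis R 0) + one, coord 0).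
  exact: james_gap_bipairing.
move=> /(_ H1 H2 H1max BH1 H2max BH2) H12; rewrite -H12 in H2q.
have E : bipairing (Defs.canon (- james_basis R 0) + one - one) (coord 0 - 0) = - 1.
  by rewrite addrK subr0.
have : 0 <= bipairing (Defs.canon (- james_basis R 0) + one - one) (coord 0 - 0).
  exact: H1max.1 _ _ H2q H1q.
by rewrite E oppr_ge0 ler10.
Qed.

End james_operator.

Theorem corollary4p11 (R : realType) :
  [/\ maximally_monotone (@pairing R (james R)) (james_op R),
      skew_operator (james_op R),
      ~ type_BR (james_op R),
      ~ unique_operator (james_op R) &
      ~ type_D (james_op R)] /\
  forall X : completeNormedModType R,
    contains_isomorphic_copy X (james R) -> ~ space_type_D X.
Proof.
split.
  split.
  - exact: james_op_maximally_monotone.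
  - exact: james_op_skew.
  - exact: james_op_not_BR.
  - exact: james_op_not_unique.
  - exact: james_op_not_type_D.
move=> X XJ XD; apply: (@james_op_not_type_D R).
by apply: (space_type_D_embedding XJ XD); exact: james_op_maximally_monotone.
Qed.
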